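(* Let $\psi:\{2,3,\dots\}\to\mathbb R$ be a monotone increasing (i.e. non-decreasing) function and let $\psi(+\infty):=\lim_{n\to\infty}\psi(n)\in\mathbb R\cup\{\infty\}$. Assume that the limit $\lim_{n\to\infty}\psi(n)/\log n\in\mathbb R\cup\{\infty\}$ exists. Then $$\dim_H\Big(\Big\{x\in(0,1)\setminus\mathbb Q:\ \lim_{n\to\infty}\frac1n\sum_{k=1}^n\psi(b_k(x))=\alpha\Big\}\Big)=1\quad\text{for all }\alpha\in[\psi(2),\psi(+\infty)]$$ if and only if $\lim_{n\to\infty}\psi(n)/\log n=\infty$ or $\psi(2)=\psi(+\infty)$. Here $b_k(x)$ are the digits of the backward continued fraction expansion of $x$ and $\dim_H$ is Hausdorff dimension.
   Context: Every irrational $x\in(0,1)$ has a unique backward continued fraction expansion $$x=1-\cfrac{1}{b_1(x)-\cfrac{1}{b_2(x)-\ddots}},\qquad b_n(x)\in\mathbb N,\ b_n(x)\ge2.$$ Equivalently, with the R\'enyi map $R(x)=\frac1{1-x}-\left[\frac1{1-x}\right]$ on $[0,1)$ ($[\cdot]$ the floor function), $b_n(x)=\left[\frac{1}{1-R^{n-1}(x)}\right]+1$. *)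

(* Defs.v *)
From mathcomp Require Import all_boot all_order all_algebra.
From mathcomp Require Import all_classical all_reals all_analysis.
From mathcomp Require Import ring lra.

Set Implicit Arguments.
Unset Strict Implicit.
Unset Printing Implicit Defensive.

Import Order.TTheory GRing.Theory Num.Theory.
Import numFieldNormedType.Exports.

Local Open Scope classical_set_scope.
Local Open Scope ring_scope.

Section HausdorffDimension.
Context {R : realType}.
Local Open Scope ereal_scope.

Definition diam (U : set R) : \bar R :=
  ereal_sup [set (`|p.1 - p.2|%R)%:E | p in U `*` U].

(* The empty set has weight 0 for every s, including s = 0 (diam set0 is -oo);
   a nonempty set has weight 1 for s = 0. *)
Definition diam_pow (s : R) (U : set R) : \bar R :=
  if U == set0 then 0 else diam U `^ s.

Definition delta_cover (delta : R) (A : set R) (U : nat -> set R) : Prop :=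
  A `<=` \bigcup_i U i /\ forall i, diam (U i) <= delta%:E.

Definition hausdorff_premeasure (s delta : R) (A : set R) : \bar R :=
  ereal_inf [set \sum_(0 <= i <oo) diam_pow s (U i) | U in delta_cover delta A].

(* The premeasure is nonincreasing in delta, so this supremum is its limit as
   delta tends to 0. *)
Definition hausdorff_measure (s : R) (A : set R) : \bar R :=
  ereal_sup [set hausdorff_premeasure s delta A | delta in [set d | (0 < d)%R]].

Definition hausdorff_dim (A : set R) : \bar R :=
  ereal_inf [set s%:E | s in [set s | (0 <= s)%R /\ hausdorff_measure s A = 0]].

End HausdorffDimension.

Section BackwardContinuedFraction.
Context {R : realType}.

Definition renyi (x : R) : R :=
  (1 - x)^-1 - (Num.floor (1 - x)^-1)%:~R.

(* Digits are numbered from 1; the index 0 is junk. For x in [0, 1[ the argument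
   of Num.truncn is positive, so Num.truncn is the floor. *)
Definition bcf_digit (n : nat) (x : R) : nat :=
  (Num.truncn (1 - iter n.-1 renyi x)^-1).+1.

Definition birkhoff_mean (psi : nat -> R) (x : R) (n : nat) : R :=
  n%:R^-1 * \sum_(1 <= k < n.+1) psi (bcf_digit k x).

Definition mean_level_set (psi : nat -> R) (alpha : \bar R) : set R :=
  [set x | [/\ 0 < x < 1, irrational x &
             (birkhoff_mean psi x n)%:E @[n --> \oo] --> alpha]].

Lemma renyi_itv (x : R) : 0 <= renyi x < 1.
Proof.
rewrite /renyi subr_ge0 floor_le andTb ltrBlDr.
by rewrite (lt_le_trans (floorD1_gt _))// intrD addrC.
Qed.

Lemma iter_renyi_itv (n : nat) (x : R) : 0 <= x < 1 -> 0 <= iter n renyi x < 1.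
Proof. by move=> x01; case: n => [|n] //=; exact: renyi_itv. Qed.

Lemma bcf_digit_ge2 (n : nat) (x : R) : 0 <= x < 1 -> (2 <= bcf_digit n x)%N.
Proof.
move=> /(iter_renyi_itv n.-1) /andP[y0 y1]; rewrite /bcf_digit ltnS truncn_ge_nat.
  by rewrite invf_ge1 ?subr_gt0// gerBl.
by rewrite invr_ge0 subr_ge0 ltW.
Qed.

(* One step of the expansion
   x = 1 - 1/(b_1 - 1/(b_2 - 1/...)), with 1 - R^n(x) = 1/(b_(n+1) - 1/...). *)
Lemma bcf_digit_step (n : nat) (x : R) : 0 <= x < 1 ->
  1 - iter n renyi x =
    ((bcf_digit n.+1 x)%:R - (1 - iter n.+1 renyi x))^-1.
Proof.
move=> /(iter_renyi_itv n) /andP[y0 y1].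
have f0 : 0 <= (1 - iter n renyi x)^-1 by rewrite invr_ge0 subr_ge0 ltW.
rewrite /bcf_digit iterS /= -natr1 truncn_floor f0 natr_absz.
rewrite ger0_norm ?floor_ge0//; move: (iter n renyi x) => y.
by rewrite /renyi -[LHS]invrK; congr (_^-1); ring.
Qed.

End BackwardContinuedFraction.

(* Main.v *)
(** Write f_b(y) = 1 - 1/(b - 1 + y), so that x = f_{b_1} o ... o f_{b_n} (R^n x) when
    b_1, ..., b_n are the first digits of x. The map f_w = f_{w_1} o ... o f_{w_n} is a
    Moebius map of determinant 1, and its denominator q + r y gives the length
    1/(q (q + r)) of the cylinder of w; the digit 2 is parabolic, and distortion is
    bounded along words that end with a digit at least 3.

    Full dimension when psi(n)/log n -> oo. Follow digit strings made of free blocks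
    2^a b with a <= A and 3 <= b <= B. They lose only a small proportion of length at
    each step, so they alone have dimension close to 1. A forced word 2^M D costs a
    factor (D (M + 2))^2 in length, that is, a bounded number of free blocks per unit
    of log D + log M. As psi(D) is much larger than log D, such words can be inserted
    so rarely that the dimension does not drop, and yet they dominate the Birkhoff
    sum: with M (alpha - psi(2)) close to psi(D) - alpha the mean tends to alpha, and
    with M = 0 it tends to oo; for alpha = psi(2) any psi works, with D = 3 and M
    large. The lower bound for the dimension does not need a Frostman measure: given a
    thin cover by sets of diameter d_i, a nested sequence of cylinders is chosen so as
    to avoid the cover, using Lebesgue measure weighted by a negative power of d_i
    near the i-th set.

    Dimension below 1 in the remaining cases, at alpha = psi(oo). By Markov's inequality
    it suffices to find s < 1, theta >= 0 and beta < alpha such that the weights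
    exp(theta (psi(b) - beta)) (b - 1)^(-2s), b >= 2, have sum less than 1. If psi is bounded,
    then theta makes the term b = 2 small, while the sum over b >= 3 is less than 1 for
    s = 11/12; if psi = O(log), take theta small and beta large. *)
Require Import Defs.
From mathcomp Require Import all_boot all_order all_algebra.
From mathcomp Require Import all_classical all_reals all_analysis.
From mathcomp Require Import ring lra zify.
Set Implicit Arguments.
Unset Strict Implicit.
Unset Printing Implicit Defensive.
Import Order.TTheory GRing.Theory Num.Theory.
Import numFieldNormedType.Exports.
Local Open Scope classical_set_scope.
Local Open Scope ring_scope.

(** * Inverse branches and cylinders *)

Section Branches.
Context {R : realType}.
Implicit Types (b : nat) (w v : seq nat) (x y z : R).

Definition branch b y : R := 1 - (b%:R - 1 + y)^-1.

Definition branches w y : R := foldr branch y w.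

(* [branches w] is a Moebius map with denominator [q + r y], (q, r) = den w. *)
Definition den w : R * R :=
  foldl (fun q b => (q.1 * (b%:R - 1) + q.2 * (b%:R - 2), q.1 + q.2)) (1, 0) w.

Definition digits w := all (leq 2) w.

Definition len w : R := branches w 1 - branches w 0.

Lemma branches_rcons w b y : branches (rcons w b) y = branches w (branch b y).
Proof. by rewrite /branches foldr_rcons. Qed.

Lemma branches_cat w v y : branches (w ++ v) y = branches w (branches v y).
Proof. by rewrite /branches foldr_cat. Qed.

Lemma den_rcons w b : den (rcons w b) =
  ((den w).1 * (b%:R - 1) + (den w).2 * (b%:R - 2), (den w).1 + (den w).2).
Proof. by rewrite /den foldl_rcons. Qed.

Lemma natr_ge2 b : (2 <= b)%N -> 2 <= b%:R :> R.
Proof. by rewrite (ler_nat _ 2). Qed.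

Lemma natr_ge3 b : (3 <= b)%N -> 3 <= b%:R :> R.
Proof. by rewrite (ler_nat _ 3). Qed.

Lemma den_ge w : digits w -> 1 <= (den w).1 /\ 0 <= (den w).2.
Proof.
elim/last_ind: w => [_|w b IH]; first by rewrite /= !lexx.
rewrite /digits all_rcons => /andP[/natr_ge2 b2 /IH[q1 r0]].
by rewrite den_rcons /=; split; nra.
Qed.

Lemma branch_itv b y : (2 <= b)%N -> 0 <= y <= 1 -> 0 <= branch b y <= 1.
Proof.
move=> /natr_ge2 b2 /andP[y0 y1]; rewrite /branch.
have z1 : 1 <= b%:R - 1 + y by lra.
rewrite subr_ge0 gerBl invr_ge0 invf_le1 ?(lt_le_trans _ z1)// z1/=.
exact: le_trans ler01 z1.
Qed.

Lemma branches_itv w y : digits w -> 0 <= y <= 1 -> 0 <= branches w y <= 1.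
Proof. by move=> + y01; elim: w => //= b w IH /andP[b2 /IH]; exact: branch_itv. Qed.

(** Determinant 1 leaves only the two denominators. The induction removes the last digit, because
    [den] grows by appending on the right. *)
Lemma branches_sub w x y : digits w -> 0 <= x <= 1 -> 0 <= y <= 1 ->
  branches w y - branches w x =
    (y - x) / (((den w).1 + (den w).2 * x) * ((den w).1 + (den w).2 * y)).
Proof.
elim/last_ind: w x y => [x y _ _ _|w b IH x y].
  by rewrite /= !mul0r !addr0 mulr1 divr1.
rewrite /digits all_rcons => /andP[b2 wd] x01 y01.
have [q1 r0] := den_ge wd.
rewrite !branches_rcons (IH _ _ wd (branch_itv b2 x01) (branch_itv b2 y01)).
rewrite den_rcons /= /branch.
move: b2 x01 y01 => /natr_ge2 b2 /andP[x0 x1] /andP[y0 y1].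
move: (den w).1 (den w).2 q1 r0 => q r q1 r0.
have xn : b%:R - 1 + x != 0 by apply/lt0r_neq0; lra.
have yn : b%:R - 1 + y != 0 by apply/lt0r_neq0; lra.
(* The new denominator is the old one at [branch b z] times [b - 1 + z]; these factors cancel
   against the difference of the two values of [branch b]. *)
have D z : b%:R - 1 + z != 0 -> q + r * (1 - (b%:R - 1 + z)^-1) =
   (q * (b%:R - 1) + r * (b%:R - 2) + (q + r) * z) / (b%:R - 1 + z).
  by move=> zn; field.
rewrite !D//.
have N z : 0 <= z -> q * (b%:R - 1) + r * (b%:R - 2) + (q + r) * z != 0.
  by move=> z0; apply/lt0r_neq0; nra.
by field; rewrite xn yn !N.
Qed.

Lemma lenE w : digits w -> len w = ((den w).1 * ((den w).1 + (den w).2))^-1.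
Proof.
move=> wd; rewrite /len branches_sub ?lexx ?ler01//.
by rewrite mulr0 addr0 mulr1 subr0 mul1r.
Qed.

Lemma len_gt0 w : digits w -> 0 < len w.
Proof. by move=> wd; have [] := den_ge wd; rewrite lenE// invr_gt0; nra. Qed.

Lemma branches_lt w x y : digits w -> 0 <= x -> x < y -> y <= 1 ->
  branches w x < branches w y.
Proof.
move=> wd x0 xy y1; have [q1 r0] := den_ge wd.
have y0 := le_trans x0 (ltW xy); have x1 := le_trans (ltW xy) y1.
rewrite -subr_gt0 branches_sub ?x0 ?y0//.
by rewrite divr_gt0 ?subr_gt0// mulr_gt0// ltr_wpDr ?mulr_ge0// (lt_le_trans ltr01).
Qed.

Lemma branches_le w x y : digits w -> 0 <= x -> x <= y -> y <= 1 ->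
  branches w x <= branches w y.
Proof.
move=> wd x0; rewrite le_eqVlt => /predU1P[->//|xy y1].
by rewrite ltW// branches_lt.
Qed.

(** Discarding the nonnegative terms in [r] from the recursion shows that [q] is at least the
    product of the [b - 1]. *)
Lemma len_le_prod w : digits w -> len w <= \prod_(b <- w) (b%:R - 1) ^- 2.
Proof.
move=> wd.
have q0 : 1 <= (\prod_(b <- w) (b%:R - 1) : R) <= (den w).1.
  elim/last_ind: w wd => [_|w b IH]; first by rewrite big_nil /= lexx.
  rewrite /digits all_rcons => /andP[/natr_ge2 b2 wd].
  have /andP[p1 pq] := IH wd; have [q1 r0] := den_ge wd.
  rewrite den_rcons -cats1 big_cat big_seq1/=.
  move: (\prod_(_ <- _) _) p1 pq => p p1 pq.
  have pb : p * (b%:R - 1) <= (den w).1 * (b%:R - 1) by rewrite ler_wpM2r//; lra.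
  have rb : 0 <= (den w).2 * (b%:R - 2) by rewrite mulr_ge0//; lra.
  by apply/andP; split; nra.
have [q1 r0] := den_ge wd; move/andP: q0 => [p1 pq].
rewrite lenE// prodfV prodrXl; move: (\prod_(_ <- _) _) p1 pq => p p1 pq.
by rewrite lef_pV2 ?posrE ?exprn_gt0 ?expr2; nra.
Qed.

Lemma renyi_def (n : nat) x y : (1 - x)^-1 = n%:R + y -> 0 <= y < 1 ->
  renyi x = y.
Proof.
move=> E /andP[y0 y1]; have F : Num.floor (n%:R + y) = n%:Z.
  by apply: floor_def; rewrite -pmulrn lerDl y0/= intrD -pmulrn ltrD2l.
by rewrite /renyi E F -pmulrn addrAC subrr add0r.
Qed.

Lemma bcf_digit_branch b y : (2 <= b)%N -> 0 <= y < 1 ->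
  bcf_digit 1 (branch b y) = b /\ renyi (branch b y) = y.
Proof.
move=> b2 y01; have b2R := natr_ge2 b2; have /andP[y0 y1] := y01.
have E : (1 - branch b y)^-1 = b.-1%:R + y.
  by rewrite /branch opprB addrC subrK invrK -[in LHS](ltn_predK b2) -natr1 addrK.
split.
  rewrite /bcf_digit/= E -[RHS](ltn_predK b2); congr _.+1.
  by apply: truncn_def; rewrite lerDl y0/= -natr1 ltrD2l.
exact: (renyi_def E).
Qed.

Lemma bcf_digitS n x : bcf_digit n.+2 x = bcf_digit n.+1 (renyi x).
Proof. by rewrite /bcf_digit/= -iterSr. Qed.

Lemma branches_co w y : digits w -> 0 <= y < 1 -> 0 <= branches w y < 1.
Proof.
move=> wd /andP[y0 y1].
have /andP[yw _] : 0 <= branches w y <= 1 by rewrite branches_itv// y0 ltW.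
have /andP[_ r1] : 0 <= branches w 1 <= 1 by rewrite branches_itv// lexx ler01.
by rewrite yw (lt_le_trans (branches_lt wd y0 y1 (lexx _))).
Qed.

Lemma bcf_digit_branches w y k : digits w -> 0 <= y < 1 -> (k < size w)%N ->
  bcf_digit k.+1 (branches w y) = nth 0%N w k.
Proof.
elim: w k => // b w IH [|k] /= /andP[b2 wd] y01 kw;
  have [] // := bcf_digit_branch b2 (branches_co wd y01).
by move=> _ E; rewrite bcf_digitS E IH.
Qed.

Lemma branch_bcf_digit n x : 0 <= x < 1 ->
  iter n renyi x = branch (bcf_digit n.+1 x) (iter n.+1 renyi x).
Proof.
move=> /(bcf_digit_step n) E.
by rewrite /branch -addrA (addrC (- 1)) -(opprB 1) -E subKr.
Qed.

Lemma branches_bcf_digit n x : 0 <= x < 1 ->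
  x = branches (mkseq (fun k => bcf_digit k.+1 x) n) (iter n renyi x).
Proof.
move=> x01; elim: n => // n IH.
by rewrite mkseqS branches_rcons -branch_bcf_digit.
Qed.

Lemma digits_bcf n x : 0 <= x < 1 -> digits (mkseq (fun k => bcf_digit k.+1 x) n).
Proof. by move=> x01; apply/allP => b /mapP[k _ ->]; exact: bcf_digit_ge2. Qed.

Lemma branches_onto w x : digits w -> branches w 0 <= x < branches w 1 ->
  exists2 y, 0 <= y < 1 & x = branches w y.
Proof.
elim: w x => [x _|b w IH x]; first by exists x.
move=> /= /andP[b2 wd] /andP[].
have /andP[l0 l1] : 0 <= branches w 0 <= 1 by rewrite branches_itv// lexx ler01.
have /andP[r0 r1] : 0 <= branches w 1 <= 1 by rewrite branches_itv// lexx ler01.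
rewrite /branch => lx xr; have b2R := natr_ge2 b2.
have x1 : 0 < 1 - x.
  by rewrite subr_gt0 (lt_le_trans xr)// gerBl invr_ge0; lra.
have [|y y01 yE] := IH ((1 - x)^-1 - (b%:R - 1)) wd.
  rewrite lerBrDr ltrBlDr addrC (addrC (branches w 1)); apply/andP; split.
    by rewrite -[leLHS]invrK lef_pV2 ?posrE ?invr_gt0//; lra.
  by rewrite -[ltRHS]invrK ltf_pV2 ?posrE ?invr_gt0//; lra.
by exists y => //; rewrite -yE addrCA subrr addr0 invrK subKr.
Qed.

(** Open on the right, as the Renyi map acts on [0, 1[; for a word of digits, membership then means
    exactly that the expansion starts with [w]. *)
Definition cyl w : set R := `[branches w 0, branches w 1[.

Lemma cyl_digits w x : digits w -> cyl w x ->
  0 <= x < 1 /\ w = mkseq (fun k => bcf_digit k.+1 x) (size w).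
Proof.
rewrite /cyl/= in_itv/= => wd /(branches_onto wd)[y y01 ->].
split; first exact: branches_co.
apply: (@eq_from_nth _ 0%N); rewrite ?size_mkseq// => k kw.
by rewrite nth_mkseq// bcf_digit_branches.
Qed.

Lemma cyl_mkseq n x : 0 <= x < 1 -> cyl (mkseq (fun k => bcf_digit k.+1 x) n) x.
Proof.
move=> x01; have wd := digits_bcf n x01.
rewrite /cyl/= in_itv/= [x in _ <= x < _](branches_bcf_digit n x01).
have /andP[y0 y1] := iter_renyi_itv n x01.
by rewrite branches_le ?branches_lt// ltW.
Qed.

Lemma cyl_cat_le w v : digits (w ++ v) ->
  branches w 0 <= branches (w ++ v) 0 /\ branches (w ++ v) 1 <= branches w 1.
Proof.
rewrite /digits all_cat => /andP[wd vd]; rewrite !branches_cat.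
have /andP[l0 l1] : 0 <= branches v 0 <= 1 by rewrite branches_itv// lexx ler01.
have /andP[r0 r1] : 0 <= branches v 1 <= 1 by rewrite branches_itv// lexx ler01.
by rewrite !branches_le.
Qed.

Lemma branches_lt1 w : w != [::] -> digits w -> branches w 1 < 1.
Proof.
case: w => //= b w _ /andP[/natr_ge2 b2 wd].
have /andP[r0 r1] : 0 <= branches w 1 <= 1 by rewrite branches_itv// lexx ler01.
by rewrite /branch gtrBl invr_gt0; lra.
Qed.

(** This is the Euclidean algorithm: [p / q] is sent to [(q mod (q - p)) / (q - p)], whose
    denominator is smaller when [p > 0]. *)
Lemma renyi_rational (p q : nat) : (p < q)%N ->
  exists n, iter n renyi (p%:R / q%:R : R) = 0.
Proof.
elim/ltn_ind: q p => q IH [|p] pq; first by exists 0%N; rewrite /= mul0r.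
have qp : (0 < q - p.+1)%N by rewrite subn_gt0.
have [|n nE] := IH (q - p.+1)%N _ (q %% (q - p.+1))%N (ltn_pmod _ qp).
  by lia.
exists n.+1; rewrite iterSr; rewrite -[RHS]nE; congr (iter n _ _).
have q0 : (q%:R : R) != 0 by rewrite pnatr_eq0; lia.
have qp0 : ((q - p.+1)%:R : R) != 0 by rewrite pnatr_eq0 -lt0n.
have E : (1 - p.+1%:R / q%:R)^-1 = q%:R / (q - p.+1)%:R :> R.
  by rewrite (natrB _ (ltnW pq)) -[X in X - _](divff q0) -mulrBl invf_div.
have D : q%:R / (q - p.+1)%:R =
    (q %/ (q - p.+1))%:R + (q %% (q - p.+1))%:R / (q - p.+1)%:R :> R.
  by rewrite {1}(divn_eq q (q - p.+1)) natrD natrM mulrDl mulfK.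
apply: (renyi_def (etrans E D)).
by rewrite divr_ge0//= ltr_pdivrMr ?ltr0n// mul1r ltr_nat ltn_mod.
Qed.

Lemma bcf_digit0 n : bcf_digit n.+1 (0 : R) = 2%N.
Proof.
have r0 : renyi (0 : R) = 0 by rewrite /renyi subr0 invr1 floor1 subrr.
by rewrite /bcf_digit/= (_ : iter n renyi 0 = 0) ?subr0 ?invr1 ?truncn1//; elim: n => //= n ->.
Qed.

(** The orbit of a rational reaches the fixed point 0, after which every digit is 2. *)
Lemma irrational_digits x : 0 <= x < 1 ->
  (forall n, exists2 k, (n <= k)%N & bcf_digit k.+1 x <> 2%N) -> irrational x.
Proof.
move=> x01 big; rewrite /irrational/= => -[r _ xE].
have [p [q [pq xpq]]] : exists p q : nat, (p < q)%N /\ x = p%:R / q%:R.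
  exists `|numq r|%N, `|denq r|%N.
  move: x01; rewrite -xE; move=> /andP[r0 r1].
  have n0 : 0 <= numq r by rewrite numq_ge0 -(ler0q R).
  have d0 : 0 < denq r by [].
  have E : ratr r = `|numq r|%N%:R / `|denq r|%N%:R :> R.
    by rewrite !natr_absz (ger0_norm n0) (gtr0_norm d0).
  split=> //; move: r1; rewrite E ltr_pdivrMr ?mul1r ?ltr_nat//.
  by rewrite ltr0n absz_gt0 gt_eqF.
have [n nE] := renyi_rational pq.
have [k nk] := big n; apply.
rewrite -(subnK nk) /bcf_digit/= iterD xpq nE.
exact: bcf_digit0.
Qed.

End Branches.

(** * Hausdorff measure *)

Section Hausdorff.
Context {R : realType}.
Implicit Types (A U : set R) (s t c d : R).
Local Open Scope ereal_scope.

Lemma diam_pow_ge0 s U : 0 <= diam_pow s U.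
Proof. by rewrite /diam_pow; case: ifP => // _; exact: poweR_ge0. Qed.

Lemma dist_le_diam U (x y : R) : U x -> U y -> `|x - y|%:E <= diam U.
Proof. by move=> Ux Uy; apply: ereal_sup_ubound; exists (x, y). Qed.

Lemma diam_le U d : (forall x y : R, U x -> U y -> (`|x - y| <= d)%R) ->
  diam U <= d%:E.
Proof.
by move=> Ud; apply: ge_ereal_sup => _ [[x y] [Ux Uy] <-]; rewrite lee_fin; exact: Ud.
Qed.

Lemma diam_ge0 U : U !=set0 -> 0 <= diam U.
Proof.
by move=> [x Ux]; apply: le_trans (dist_le_diam Ux Ux); rewrite subrr normr0.
Qed.

Lemma diam_pow_le s d U : (0 <= s)%R -> (0 <= d)%R ->
  (forall x y : R, U x -> U y -> (`|x - y| <= d)%R) ->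
  diam_pow s U <= (d `^ s)%:E.
Proof.
move=> s0 d0 Ud; rewrite /diam_pow; case: eqP => [_|/eqP/set0P U0].
  by rewrite lee_fin powR_ge0.
rewrite -poweR_EFin gt0_ler_poweR// ?in_itv/= ?leey ?andbT ?lee_fin//.
  exact: diam_ge0.
exact: diam_le.
Qed.

Lemma hausdorff_premeasure_ge0 s d A : 0 <= hausdorff_premeasure s d A.
Proof.
apply: le_ereal_inf_tmp => _ [U _ <-].
by apply: nneseries_ge0 => i _ _; exact: diam_pow_ge0.
Qed.

Lemma hausdorff_measure_ge0 s A : 0 <= hausdorff_measure s A.
Proof.
apply: le_trans (hausdorff_premeasure_ge0 s 1 A) _.
by apply: ereal_sup_ubound; exists 1%R => //=; exact: ltr01.
Qed.

Lemma nneseries_ge_term (f : nat -> \bar R) i : (forall n, 0 <= f n) ->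
  f i <= \sum_(0 <= n <oo) f n.
Proof.
move=> f0; apply: (@le_trans _ _ (\sum_(0 <= n < i.+1) f n)).
  by rewrite big_nat_recr//= leeDr// sume_ge0.
exact: nneseries_lim_ge.
Qed.

Lemma nneseries_le (f : nat -> \bar R) (M : \bar R) : (forall n, 0 <= f n) ->
  (forall N, \sum_(0 <= n < N) f n <= M) -> \sum_(0 <= n <oo) f n <= M.
Proof.
move=> f0 fM; apply: lime_le; first exact: is_cvg_nneseries.
by apply: nearW => N; exact: fM.
Qed.

(** The covers need no bound on diameters: for [s > 0], a total weight at most [d^s] already forces
    every diameter to be at most [d]. *)
Lemma hausdorff_measure_eq0 s A : (0 < s)%R ->
  (forall c, (0 < c)%R -> exists2 U : nat -> set R, A `<=` \bigcup_i U i &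
     \sum_(0 <= i <oo) diam_pow s (U i) <= c%:E) ->
  hausdorff_measure s A = 0.
Proof.
move=> s0 small; apply/eqP; rewrite eq_le hausdorff_measure_ge0 andbT.
apply: ge_ereal_sup => _ [d /= d0 <-].
apply/lee_addgt0Pr => c c0; rewrite add0e.
have [|U AU Uc] := small (Num.min c (d `^ s)%R).
  by rewrite lt_min c0 powR_gt0.
apply: le_trans (_ : _ <= (Num.min c (d `^ s)%R)%:E) _; last first.
  by rewrite lee_fin ge_min lexx.
apply: (le_trans _ Uc); apply: ereal_inf_lbound; exists U => //; split => // i.
have [/eqP ->|U0] := boolP (U i == set0).
  by rewrite /diam; apply: ge_ereal_sup => _ [[x y] []//].
have: diam_pow s (U i) <= (d `^ s)%:E.
  apply: le_trans (_ : _ <= (Num.min c (d `^ s)%R)%:E) _; last first.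
    by rewrite lee_fin ge_min lexx orbT.
  apply: le_trans Uc; apply: (@nneseries_ge_term (fun i => diam_pow s (U i))) => n.
  exact: diam_pow_ge0.
rewrite /diam_pow (negbTE U0).
move/set0P: U0 => /diam_ge0; case: (diam (U i)) => [r| |]//; last first.
  by rewrite poweRyr ?gt_eqF// leye_eq.
rewrite poweR_EFin !lee_fin => r0; apply: contraTT; rewrite -!ltNge => dr.
by rewrite gt0_ltr_powR// ?nnegrE// ltW.
Qed.

(** The exponent can be raised to [t] because the diameters are at most 1. The [d i] are made
    positive even for empty sets and singletons, since negative powers of them are taken later. *)
Lemma hausdorff_null_cover s t c A : (0 <= s)%R -> (s <= t)%R -> (0 < t)%R ->
  (0 < c)%R -> hausdorff_measure s A = 0 ->
  exists (U : nat -> set R) (d : nat -> R),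
    [/\ A `<=` \bigcup_i U i, forall i, (0 < d i <= 1)%R,
        forall i (x y : R), U i x -> U i y -> (`|x - y| <= d i)%R &
        \sum_(0 <= i <oo) (d i `^ t)%:E < c%:E].
Proof.
move=> s0 st t0 c0 sA.
have c20 : (0 < c / 3)%R by rewrite divr_gt0.
have [|_ [U [AU Ud] <-] Uc] :=
    @ereal_inf_lt R [set \sum_(0 <= i <oo) diam_pow s (U i) | U in delta_cover 1 A] (c / 3)%:E.
  apply: le_lt_trans (_ : _ <= 0) _; last by rewrite lte_fin.
  rewrite -[leRHS]sA; apply: ereal_sup_ubound; exists 1%R; first exact: ltr01.
  by [].
(* The [t]-th powers of the [e i] sum to at most [c / 3], and the cover itself weighs less than
   [c / 3]. *)
pose e i : R := Num.min 1%R ((c / 3 / (2 ^ i.+1)%:R) `^ t^-1)%R.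
have e0 i : (0 < e i)%R.
  by rewrite lt_min ltr01/= powR_gt0// divr_gt0// ltr0n expn_gt0.
have et i : (e i `^ t <= c / 3 / (2 ^ i.+1)%:R)%R.
  have p0 : (0 <= c / 3 / (2 ^ i.+1)%:R)%R by rewrite divr_ge0// ltW.
  rewrite -[leRHS]powRr1// -[X in (_ <= _ `^ X)%R](@mulVf _ t) ?gt_eqF// powRrM.
  apply: ge0_ler_powR; rewrite ?nnegrE ?powR_ge0 ?(ltW t0) ?(ltW (e0 i))//.
  by rewrite ge_min lexx orbT.
pose d i : R := if U i == set0 then e i else Num.max (fine (diam (U i))) (e i).
have dE i : U i != set0 -> [/\ diam (U i) = (fine (diam (U i)))%:E,
    (0 <= fine (diam (U i)))%R & (fine (diam (U i)) <= 1)%R].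
  move=> /set0P /diam_ge0; have := Ud i; case: (diam (U i)) => [r| |]/=.
  - by rewrite !lee_fin => ? ?.
  - by rewrite leye_eq.
  - by rewrite leeNy_eq.
exists U, d; split => //.
- move=> i; rewrite /d; case: ifPn => [_|/dE[_ D0 D1]].
    by rewrite e0 ge_min lexx.
  by rewrite lt_max e0 orbT ge_max D1 ge_min lexx.
- move=> i x y Ux Uy; rewrite /d ifF; last by apply/negbTE/set0P; exists x.
  have [] := dE i; first by apply/set0P; exists x.
  move=> E _ _; rewrite le_max -lee_fin; apply/orP; left.
  by rewrite -E; exact: dist_le_diam.
- apply: (@le_lt_trans _ _ (\sum_(0 <= i <oo)
      (diam_pow s (U i) + (c / 3 / (2 ^ i.+1)%:R)%:E))).
    apply: lee_nneseries => i _; first by rewrite lee_fin powR_ge0.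
    rewrite /d /diam_pow; case: ifPn => [_|/dE[E D0 D1]].
      by rewrite add0e lee_fin.
    rewrite E poweR_EFin -EFinD lee_fin /Num.max; case: ifPn => _.
      by rewrite (le_trans (et i))// lerDr powR_ge0.
    apply: (@le_trans _ _ (fine (diam (U i)) `^ s)%R); last first.
      by rewrite lerDl divr_ge0// ltW.
    move: D0; rewrite le_eqVlt => /predU1P[<-|D0].
      by rewrite powR0 ?gt_eqF// powR_ge0.
    by rewrite ger_powR// D0.
  apply: le_lt_trans (epsilon_trick _ _ _) _ => //.
  - by move=> n; exact: diam_pow_ge0.
  - exact: ltW.
  apply: lt_trans (_ : (c / 3)%:E + (c / 3)%:E < _).
    by apply: lte_leD.
  by rewrite -EFinD lte_fin; lra.
Qed.

(** Cover by [n] intervals of length [1/n], of total weight [n^(1 - s)], with [n] so large that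
    [n^(s - 1) >= 1/c]. *)
Lemma hausdorff_measure_gt1 s A : (1 < s)%R -> A `<=` `[0%R, 1%R[ ->
  hausdorff_measure s A = 0.
Proof.
move=> s1 A01; apply: hausdorff_measure_eq0 => [|c c0]; first by lra.
pose n := (Num.truncn (c^-1 `^ (s - 1)^-1)%R).+1.
have n0 : (0 < n%:R :> R)%R by rewrite ltr0n.
exists (fun i => if (i < n)%N then `[(i%:R / n%:R)%R, (i.+1%:R / n%:R)%R]%classic else set0).
  move=> x /A01; rewrite /= in_itv/= => /andP[x0 x1].
  have xn0 : (0 <= x * n%:R)%R by rewrite mulr_ge0// ltW.
  have /andP[k1 k2] := truncn_itv xn0.
  exists (Num.truncn (x * n%:R)) => //=; rewrite ifT; last first.
    by rewrite -(ltr_nat R) (le_lt_trans k1)// -[ltRHS]mul1r ltr_pM2r.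
  by rewrite /= in_itv/= ler_pdivrMr// k1/= ler_pdivlMr// ltW.
apply: nneseries_le => [i|N]; first exact: diam_pow_ge0.
apply: (@le_trans _ _ (\sum_(0 <= i < N | (i < n)%N) (n%:R^-1 `^ s)%:E)).
  rewrite [leRHS]big_mkcond/=; apply: lee_sum => i _; case: ifP => _.
    apply: diam_pow_le; rewrite ?invr_ge0//; first by lra.
    move=> x y; rewrite /= !in_itv/= -natr1 mulrDl mul1r => /andP[? ?] /andP[? ?].
    by rewrite ler_norml; lra.
  by rewrite /diam_pow eqxx.
apply: (@le_trans _ _ (\sum_(0 <= i < n) (n%:R^-1 `^ s)%:E)).
  rewrite [leLHS](big_nat_widen _ _ (maxn n N)) ?leq_maxr//.
  rewrite [leRHS](big_nat_widen _ _ (maxn n N)) ?leq_maxl//.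
  rewrite [leLHS]big_mkcond [leRHS]big_mkcond; apply: lee_sum => i _.
  by case: ifP => [/andP[-> _]//|_]; case: ifP => // _; rewrite lee_fin powR_ge0.
rewrite sumEFin lee_fin big_const_nat subn0 iter_addr_0.
have E : (n%:R^-1 `^ s * n%:R = (n%:R `^ (s - 1))^-1 :> R)%R.
  rewrite -(powR_inv1 (ltW n0)) -powRrM -[X in (_ * X)%R](powRr1 (ltW n0)).
  by rewrite -powRD ?(gt_eqF n0) ?implybT// -powRN; congr (_ `^ _)%R; lra.
have q0 : (0 <= c^-1 `^ (s - 1)^-1 :> R)%R by rewrite powR_ge0.
have /andP[_ /ltW nq] := truncn_itv q0.
rewrite -[leLHS]mulr_natr E -[leRHS]invrK lef_pV2 ?posrE ?invr_gt0 ?powR_gt0//.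
have c1 : (0 <= c^-1)%R by rewrite invr_ge0 ltW.
rewrite -[leLHS](powRr1 c1) -[X in (_ `^ X <= _)%R](@mulVf _ (s - 1)%R); last first.
  by rewrite gt_eqF// subr_gt0.
rewrite powRrM; apply: ge0_ler_powR; rewrite ?nnegrE//.
by rewrite subr_ge0 ltW.
Qed.

Lemma hausdorff_dim_eq1 A : A `<=` `[0%R, 1%R[ ->
  (forall s, (0 <= s)%R -> (s < 1)%R -> hausdorff_measure s A != 0) ->
  hausdorff_dim A = 1.
Proof.
move=> A01 pos; apply/eqP; rewrite eq_le; apply/andP; split.
  apply/lee_addgt0Pr => e e0; rewrite -EFinD.
  apply: ereal_inf_lbound; exists (1 + e)%R => //; split; first by lra.
  by apply: hausdorff_measure_gt1 => //; lra.
apply: le_ereal_inf_tmp => _ [s [s0 sA] <-]; rewrite lee_fin leNgt.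
by apply/negP => /(pos s s0); rewrite sA eqxx.
Qed.

Lemma hausdorff_dim_lt1 s A : (0 <= s)%R -> (s < 1)%R ->
  hausdorff_measure s A = 0 -> hausdorff_dim A < 1.
Proof.
move=> s0 s1 sA; apply: (@le_lt_trans _ _ s%:E); last by rewrite lte_fin.
by apply: ereal_inf_lbound; exists s.
Qed.

End Hausdorff.

(** * Lengths of cylinders *)

Section Full.
Context {R : realType}.
Implicit Types (w v e : seq nat).
Local Notation den := (@den R).
Local Notation len := (@len R).

(* Bounded distortion holds for words that do not end with the parabolic digit 2. *)
Definition full w := digits w && (2 < last 3 w)%N.

(** The default 2 of [last] excludes the empty word, whereas the default 3 in [full] admits it as
    the start of a path. *)
Definition closing e := digits e && (2 < last 2 e)%N.

Lemma digits_rcons w b : digits (rcons w b) = (1 < b)%N && digits w.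
Proof. exact: all_rcons. Qed.

Lemma closingP e : closing e -> exists v b, [/\ e = rcons v b, digits v & (2 < b)%N].
Proof.
case: (lastP e) => // v b; rewrite /closing digits_rcons last_rcons.
by move=> /andP[/andP[_ vd] b3]; exists v, b.
Qed.

Lemma digits_cat w v : digits (w ++ v) = digits w && digits v.
Proof. exact: all_cat. Qed.

Lemma full_cat w e : digits w -> closing e -> full (w ++ e).
Proof.
move=> wd /closingP[v [b [-> vd b3]]].
by rewrite /full digits_cat wd digits_rcons vd (ltnW b3) -rcons_cat last_rcons.
Qed.

Lemma den_cat_ge w v : digits w -> digits v -> (den w).1 <= (den (w ++ v)).1.
Proof.
move=> wd; elim/last_ind: v => [|v b IH]; first by rewrite cats0.
rewrite digits_rcons => /andP[/(@natr_ge2 R) b2 vd].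
rewrite -rcons_cat den_rcons/= (le_trans (IH vd))//.
have [|q1 r0] := @den_ge R (w ++ v); first by rewrite digits_cat wd.
by nra.
Qed.

(** A last digit at least 3 doubles [q], so a concatenation of [j] closing words has length at most
    [4^-j]. *)
Lemma den_closing w e : digits w -> closing e ->
  2 * (den w).1 <= (den (w ++ e)).1.
Proof.
move=> wd /closingP[v [b [-> vd /(@natr_ge3 R) b3]]].
rewrite -rcons_cat den_rcons/=; have := den_cat_ge wd vd.
have [|q1 r0] := @den_ge R (w ++ v); first by rewrite digits_cat wd.
by nra.
Qed.

(** The inequality [r <= q] is the bounded distortion: [q + r y] varies by a factor at most 2 over
    [0, 1]. *)
Lemma den_full w : full w -> [/\ digits w, 1 <= (den w).1, 0 <= (den w).2 &
  (den w).2 <= (den w).1].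
Proof.
move=> /andP[wd w3]; have [q1 r0] := @den_ge R w wd; split => //.
move: wd w3 {q1 r0}; case: (lastP w) => [|v b]; first by rewrite /= ler01.
rewrite digits_rcons last_rcons => /andP[_ vd] /(@natr_ge3 R) b3.
by rewrite den_rcons /=; have [q1 r0] := @den_ge R v vd; nra.
Qed.

(** Parabolicity of the digit 2: lengths decay only polynomially along a run of 2. *)
Lemma den_nseq2 w a : den (w ++ nseq a 2%N) = ((den w).1, (den w).2 + (den w).1 * a%:R).
Proof.
elim: a => [|a IH]; first by rewrite cats0 mulr0 addr0; case: den.
rewrite -addn1 nseqD catA cats1 den_rcons IH/= natrD.
by congr (_, _); ring.
Qed.

Lemma digits_nseq2 a : digits (nseq a 2%N).
Proof. by rewrite /digits all_nseq orbT. Qed.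

(** The shift by 3 lets the index of the last digit run through an ordinal. *)
Definition block a b := rcons (nseq a 2%N) b.+3.

Definition ins M D := rcons (nseq M 2%N) D.

(** As [r <= q], the new denominators satisfy [q' + r' <= D (M + 2) q]; squaring bounds the loss of
    length. *)
Lemma ins_cost w M D : full w -> (2 < D)%N ->
  len w <= (D * M.+2)%:R ^+ 2 * len (w ++ ins M D).
Proof.
move=> /den_full[wd q1 r0 rq] D3; have D3R := @natr_ge3 R _ D3.
have id : digits (w ++ ins M D).
  by rewrite digits_cat wd digits_rcons digits_nseq2 (ltnW D3).
rewrite !lenE// /ins -rcons_cat den_rcons den_nseq2/= natrM -natr1 -natr1.
move: (den w).1 (den w).2 q1 r0 rq => q r q1 r0 rq.
have m0 : (0 : R) <= M%:R by [].
move: (M%:R : R) (D%:R : R) m0 D3R => m x m0 x3.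
set q' := q * (x - 1) + _; set r' := q + (r + q * m).
have qm : 0 <= q * m by rewrite mulr_ge0//; lra.
have q'0 : 0 < q'.
  have : 0 <= (r + q * m) * (x - 2) by rewrite mulr_ge0//; lra.
  by rewrite /q'; nra.
have r'0 : 0 <= r' by rewrite /r'; lra.
have s0 : q' + r' <= (x * (m + 1 + 1)) * q.
  have : r * (x - 1) <= q * (x - 1) by rewrite ler_wpM2r//; lra.
  by rewrite /q' /r'; lra.
have qq : 0 < q * (q + r) by nra.
have q'r' : 0 < q' * (q' + r') by rewrite mulr_gt0// ltr_wpDr.
rewrite ler_pdivlMr// [leLHS]mulrC ler_pdivrMr//.
apply: (@le_trans _ _ ((x * (m + 1 + 1) * q) ^+ 2)).
  rewrite expr2; apply: ler_pM => //; first exact: ltW.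
  - by rewrite addr_ge0// ltW.
  - by rewrite (le_trans _ s0)// lerDl.
rewrite exprMn ler_wpM2l ?sqr_ge0//; nra.
Qed.

Lemma sum_len_digits v B : digits v ->
  \sum_(b < B) len (rcons v b.+3) =
    branches v (1 - B.+2%:R^-1) - branches v (1 - 2^-1).
Proof.
move=> vd; rewrite -(big_mkord xpredT (fun b => len (rcons v b.+3))).
rewrite -(@telescope_sumr _ 0 B (fun b => branches v (1 - b.+2%:R^-1)))//.
apply: eq_bigr => b _; rewrite /len !branches_rcons /branch.
by congr (branches v (1 - _^-1) - branches v (1 - _^-1));
  rewrite -[b.+3%:R]natr1; ring.
Qed.

(** The cylinder of [w 2^a] splits into that of [w 2^(a+1)] and those of [w 2^a b], [b >= 3]. The
    sum over [a] telescopes; what is lost is the digits beyond [B + 2] for each [a], and the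
    remaining run [w 2^(A+1)]. *)
Lemma sum_len_blocks w A B : full w ->
  (1 - 2 / A.+2%:R - 2 * A.+1%:R / B.+2%:R) * len w <=
    \sum_(a < A.+1) \sum_(b < B) len (w ++ block a b).
Proof.
move=> wf; have [wd q1 r0 rq] := den_full wf.
pose v a := w ++ nseq a 2%N.
have vd a : digits (v a) by rewrite digits_cat wd digits_nseq2.
have vS a : v a.+1 = rcons (v a) 2 by rewrite /v -addn1 nseqD catA cats1.
have qr0 : 0 < (den w).1 * ((den w).1 + (den w).2) by nra.
have lw : len w = ((den w).1 * ((den w).1 + (den w).2))^-1 by rewrite lenE.
have E a : \sum_(b < B) len (w ++ block a b) =
    len (v a) - len (v a.+1) - (branches (v a) 1 - branches (v a) (1 - B.+2%:R^-1)).
  under eq_bigr => b _ do rewrite /block -rcons_cat.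
  rewrite (sum_len_digits _ (vd a)) vS /len !branches_rcons /branch.
  rewrite (_ : 2%:R - 1 + 0 = 1 :> R); last by ring.
  rewrite (_ : 2%:R - 1 + 1 = 2 :> R); last by ring.
  by rewrite invr1 subrr; ring.
have tail a : branches (v a) 1 - branches (v a) (1 - B.+2%:R^-1) <= 2 / B.+2%:R * len w.
  have i01 : 0 < (B.+2%:R^-1 : R) <= 1.
    by rewrite invr_gt0 ltr0Sn/= invf_le1 ?ltr0Sn// ler1n.
  move: (B.+2%:R^-1) i01 => i /andP[i0 i1].
  rewrite branches_sub//; [|lra|lra]; rewrite den_nseq2/= lw.
  rewrite (_ : 1 - (1 - i) = i); last by ring.
  have a0 : (0 : R) <= a%:R by [].
  move: (a%:R : R) (den w).1 (den w).2 a0 q1 r0 rq qr0 => {}a q r a0 q1 r0 rq qr0.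
  have qa : 0 <= q * a by nra.
  rewrite (mulrC 2) -mulrA ler_wpM2l//; first exact: ltW.
  have d1 : q <= q + (r + q * a) * (1 - i) by rewrite lerDl mulr_ge0//; lra.
  have d2 : q <= q + (r + q * a) * 1 by rewrite mulr1; lra.
  have d3 : q * q <= (q + (r + q * a) * (1 - i)) * (q + (r + q * a) * 1).
    by apply: ler_pM => //; lra.
  rewrite ler_pdivlMr// [leLHS]mulrC ler_pdivrMr; nra.
have last : len (v A.+1) <= 2 / A.+2%:R * len w.
  rewrite lenE// den_nseq2/= lw -[A.+2%:R]natr1.
  have a0 : (0 : R) <= A.+1%:R by [].
  move: (A.+1%:R : R) (den w).1 (den w).2 a0 q1 r0 rq qr0 => a q r a0 q1 r0 rq qr0.
  have qa : 0 <= q * a by nra.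
  have D0 : 0 < q * (q + (r + q * a)) by nra.
  have a1 : 0 < a + 1 by lra.
  have E0 : 0 < (a + 1) * (q * (q + r)) by rewrite mulr_gt0.
  rewrite -mulrA -invfM ler_pdivlMr// [leLHS]mulrC ler_pdivrMr//.
  have : r * (a + 1) <= q * (a + 1) by rewrite ler_wpM2r//; lra.
  nra.
under eq_bigr => a _ do rewrite E.
rewrite big_split/= sumrN.
rewrite -(big_mkord xpredT (fun a => len (v a) - len (v a.+1))).
under eq_bigr => a _ do rewrite -opprB.
rewrite sumrN telescope_sumr// opprB /v cats0 -/(v A.+1).
have S : \sum_(a < A.+1) (branches (v a) 1 - branches (v a) (1 - B.+2%:R^-1)) <=
    2 * A.+1%:R / B.+2%:R * len w.
  apply: (@le_trans _ _ (\sum_(a < A.+1) (2 / B.+2%:R * len w))).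
    by apply: ler_sum => a _; exact: tail.
  rewrite sumr_const card_ord -mulr_natr le_eqVlt; apply/orP; left; apply/eqP.
  by ring.
by rewrite !mulrBl mul1r; apply: lerB => //; apply: lerB.
Qed.

End Full.

(** * Avoiding a thin cover *)

Section Path.
Context {R : realType} {T : finType}.
Variable ext : nat -> T -> seq nat.
Local Notation len := (@len R).
Local Notation cyl := (@cyl R).
Local Notation lebesgue := (@lebesgue_measure R).

Fixpoint word (t : nat -> T) j :=
  if j is i.+1 then word t i ++ ext i (t i) else [::].

Lemma measurable_cyl w : measurable (cyl w).
Proof. exact: measurable_itv. Qed.

Lemma lebesgue_cyl w : digits w -> lebesgue (cyl w) = (len w)%:E.
Proof.
move=> wd; rewrite /cyl lebesgue_measure_itv/= lte_fin ifT// -subr_gt0.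
exact: (@len_gt0 R).
Qed.

Lemma cyl_cat w v : digits (w ++ v) -> cyl (w ++ v) `<=` cyl w.
Proof.
move=> /(@cyl_cat_le R)[l r] x; rewrite /cyl/= !in_itv/= => /andP[lx xr].
by rewrite (le_trans l)// (lt_le_trans xr).
Qed.

Hypothesis ext_closing : forall j t, closing (ext j t).
Hypothesis ext_inj : forall j w t u x, digits w ->
  cyl (w ++ ext j t) x -> cyl (w ++ ext j u) x -> t = u.

Lemma digits_ext j t w : digits w -> digits (w ++ ext j t).
Proof. by move=> wd; rewrite digits_cat wd; have /andP[] := ext_closing j t. Qed.

Lemma full_word t j : full (word t j).
Proof.
elim: j => //= j /andP[wd _]; exact: full_cat.
Qed.

Lemma digits_word t j : digits (word t j).
Proof. by have /andP[] := full_word t j. Qed.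

(** [K j] compensates for the length lost in the first [j] extensions. *)
Variable (K : nat -> R).
Hypothesis K_step : forall j w, full w ->
  K j * len w <= K j.+1 * \sum_t len (w ++ ext j t).

(** A light cylinder has a light extension: otherwise, summing over its disjoint extensions and
    using [K_step] would make it heavy. *)
Lemma measure_path (mu : {measure set (measurableTypeR R) -> \bar R}) :
  (mu (cyl [::]) < (K 0)%:E)%E ->
  exists t, forall j, (mu (cyl (word t j)) < (K j * len (word t j))%:E)%E.
Proof.
move=> mu0.
pose P j w := full w /\ (mu (cyl w) < (K j * len w)%:E)%E.
have step j w : P j w -> exists t, P j.+1 (w ++ ext j t).
  move=> [wf muw]; have /andP[wd _] := wf.
  apply: contrapT => /forallNP no.
  have {}no t : ((K j.+1 * len (w ++ ext j t))%:E <= mu (cyl (w ++ ext j t)))%E.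
    rewrite leNgt; apply/negP => lt; apply: (no t); split => //.
    exact: full_cat.
  have : (\sum_(t : T) mu (cyl (w ++ ext j t)) <= mu (cyl w))%E.
    rewrite -big_enum fsbig_seq ?enum_uniq//= -measure_fin_bigcup//.
    - apply: le_measure; rewrite ?inE.
      + by apply: fin_bigcup_measurable => // t _; exact: measurable_cyl.
      + exact: measurable_cyl.
      + by move=> x [t _]; apply: cyl_cat; exact: digits_ext.
    - move=> t u _ _ [x [xt xu]]; exact: ext_inj xt xu.
    - by move=> t _; exact: measurable_cyl.
  apply/negP; rewrite -ltNge; apply: (lt_le_trans muw).
  apply: (@le_trans _ _ (\sum_t (K j.+1 * len (w ++ ext j t))%:E)%E); last first.
    by apply: lee_sum => t _; exact: no.
  by rewrite sumEFin lee_fin -mulr_sumr K_step.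
have P0 : P 0%N [::].
  split => //; rewrite /len /branches /= subr0 mulr1//.
(* [t0] is the default choice outside [P], where nothing is required. *)
have [t0 _] := step _ _ P0.
have [f fP] : exists f : nat -> seq nat -> T,
    forall j w, P j w -> P j.+1 (w ++ ext j (f j w)).
  have /choice[f fP] : forall jw : nat * seq nat, exists t, P jw.1 jw.2 ->
      P jw.1.+1 (jw.2 ++ ext jw.1 t).
    move=> [j w]; have [/step[t Pt]|nP] := pselect (P j w); first by exists t.
    by exists t0.
  by exists (fun j w => f (j, w)) => j w Pw; exact: (fP (j, w)).
pose ws := fix ws j := if j is i.+1 then ws i ++ ext i (f i (ws i)) else [::].
pose t j := f j (ws j).
have wE j : word t j = ws j by elim: j => //= j ->.
exists t => j; rewrite wE.
suff : P j (ws j) by case.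
by elim: j => //= j; exact: fP.
Qed.

Lemma ext_nonnil j t : ext j t != [::].
Proof. by apply/eqP => e; have := ext_closing j t; rewrite e. Qed.

(** The supremum of the left ends could be an excluded right end; this cannot happen because the
    right ends decrease strictly. *)
Lemma word_limit t : exists x : R, forall j, cyl (word t j) x.
Proof.
pose l j : R := branches (word t j) 0; pose r j : R := branches (word t j) 1.
have lr_mono j : l j <= l j.+1 /\ r j.+1 < r j.
  have d := digits_word t j; have dS := digits_word t j.+1.
  have [lS _] := @cyl_cat_le R _ _ dS; split => //.
  rewrite /r/= branches_cat branches_lt//.
    have /andP[ed _] := ext_closing j (t j).
    have /andP[e0 _] : 0 <= @branches R (ext j (t j)) 1 <= 1.
      by rewrite branches_itv// lexx ler01.
    by [].
  by apply: branches_lt1; [exact: ext_nonnil|have /andP[] := ext_closing j (t j)].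
have lm : {homo l : i j / (i <= j)%N >-> i <= j}.
  by apply: homo_leq => // [? ? ?|j]; [exact: le_trans|exact: (lr_mono j).1].
have rm i j : (i <= j)%N -> r j <= r i.
  elim: j => [|j IH]; first by rewrite leqn0 => /eqP->.
  rewrite leq_eqVlt => /predU1P[->//|/IH]; apply: le_trans.
  by rewrite ltW// (lr_mono j).2.
have lr i j : l i <= r j.
  apply: (le_trans (lm _ _ (leq_maxl i j))); apply: le_trans (rm _ _ (leq_maxr i j)).
  by apply: branches_le => //; exact: digits_word.
have ub j : ubound (range l) (r j) by move=> _ [i _ <-]; exact: lr.
have hs : has_sup (range l) by split; [exists (l 0%N), 0%N|exists (r 0%N); exact: ub].
exists (sup (range l)) => j; rewrite /cyl/= in_itv/=; apply/andP; split.
  by apply: ub_le_sup; [exists (r 0%N); exact: ub|exists j].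
apply: le_lt_trans (lr_mono j).2; apply: ge_sup; [by case: hs|exact: ub].
Qed.

Lemma len_word t j : len (word t j) <= 4 ^- j.
Proof.
have q2 : (2 ^+ j : R) <= (den (word t j)).1.
  elim: j => //= j IH; rewrite exprS (le_trans _ (den_closing _ _))//.
  - by rewrite ler_pM2l.
  - exact: digits_word.
have [wd q1 r0 _] := @den_full R _ (full_word t j).
rewrite lenE// lef_pV2 ?posrE ?exprn_gt0//; last by nra.
rewrite (_ : 4 = 2 * 2 :> R); last by ring.
have p0 : (0 : R) < 2 ^+ j by rewrite exprn_gt0.
by rewrite exprMn; nra.
Qed.

Variable (dl : R).
Hypothesis dl_ge0 : 0 <= dl.
Hypothesis K0 : K 0 = 1.
Hypothesis K_le : forall j, K j <= (4 `^ dl) ^+ j.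

(* If a cover is thin, weigh the Lebesgue measure near the set [U i] by
   [4^dl d_i^(-dl)]. Some path stays lighter than [K j] times Lebesgue measure,
   and a point of [U i] on this path would contradict it at the scale [d i]. *)
Lemma avoid_cover (U : nat -> set R) (d : nat -> R) :
  (forall i, 0 < d i <= 1) ->
  (forall i x y, U i x -> U i y -> `|x - y| <= d i) ->
  (\sum_(0 <= i <oo) (d i `^ (1 - dl))%:E < ((4 * 4 `^ dl)^-1)%:E)%E ->
  exists t x, (forall j, cyl (word t j) x) /\ forall i, ~ U i x.
Proof.
move=> d01 Ud thin.
pose u i : R := xget 0 (U i).
(* The radius [2 * d i] suffices to contain any cylinder of length at most [d i] that meets [U i],
   as [u i] is then a point of [U i]. *)
pose V i : set R := [set` `[u i - 2 * d i, u i + 2 * d i]%R].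
have mV i : measurable (V i : set (measurableTypeR R)) by exact: measurable_itv.
pose w i := 4 `^ dl * d i `^ (- dl).
have w0 i : 0 <= w i by rewrite mulr_ge0// powR_ge0.
pose mu := mseries (fun i => mscale (NngNum (w0 i)) (mrestr lebesgue (mV i))) 0.
have VE i : lebesgue (V i) = (4 * d i)%:E.
  have /andP[d0 _] := d01 i.
  rewrite lebesgue_measure_itv/= lte_fin ifT; last by lra.
  by rewrite -EFinD; congr _%:E; ring.
(* The [i]-th term has mass at most [w i * 4 d i = 4 * 4^dl * d i^(1 - dl)], and [thin] makes these
   sum to less than 1. *)
have mu0 : (mu (cyl [::]) < (K 0)%:E)%E.
  rewrite K0; apply: (@le_lt_trans _ _
    (\sum_(0 <= i <oo) (4 * 4 `^ dl)%:E * (d i `^ (1 - dl))%:E)%E).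
    apply: lee_nneseries => i _; first by move=> _; exact: measure_ge0.
    rewrite /mscale/= /mrestr; apply: (@le_trans _ _ ((w i)%:E * lebesgue (V i))%E).
      apply: lee_wpmul2l; first by rewrite lee_fin.
      apply: le_measure; rewrite ?inE//.
      by apply: measurableI => //; exact: measurable_cyl.
    rewrite VE -!EFinM lee_fin /w le_eqVlt; apply/orP; left; apply/eqP.
    have /andP[d0 _] := d01 i.
    rewrite powRD; last by rewrite (gt_eqF d0) implybT.
    by rewrite powRr1 ?(ltW d0)//; ring.
  have c0 : 0 < 4 * 4 `^ dl :> R by rewrite mulr_gt0// powR_gt0.
  rewrite nneseriesZl; last by move=> i _; rewrite lee_fin powR_ge0.
  by rewrite -lte_pdivlMl// mule1.
have [t tP] := measure_path mu0.
have [x xP] := word_limit t.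
exists t, x; split => // i Ux.
have /andP[d0 d1] := d01 i.
have exj : exists j, 4 ^- j <= d i.
  exists (Num.truncn (d i)^-1); have di0 : 0 <= (d i)^-1 by rewrite invr_ge0 ltW.
  have /andP[_ /ltW dj] := truncn_itv di0.
  rewrite -[leRHS]invrK lef_pV2 ?posrE ?exprn_gt0 ?invr_gt0// (le_trans dj)//.
  by rewrite -natrX ler_nat ltn_expl.
(* At the least [j] with [4^-j <= d i] the cylinder lies in [V i], while minimality gives
   [4^(dl j) <= w i]. *)
case: (ex_minnP exj) => j jd jmin.
have key : w i < K j.
  have wd := digits_word t j.
  have l0 : 0 < len (word t j) by exact: len_gt0.
  rewrite -(ltr_pM2r l0) -lte_fin; apply: le_lt_trans (tP j).
  rewrite EFinM -lebesgue_cyl//.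
  apply: (@le_trans _ _ (mscale (NngNum (w0 i)) (mrestr lebesgue (mV i)) (cyl (word t j)))).
    rewrite /mscale/= /mrestr (_ : cyl (word t j) `&` V i = cyl (word t j))//.
    apply/setIidPl => y; move: (xP j); rewrite /cyl /V/= !in_itv/=.
    move=> /andP[x1 x2] /andP[y1 y2].
    have := len_word t j; rewrite /len => len4.
    have : `|x - u i| <= d i by apply: Ud => //; rewrite /u; case: xgetP => // /(_ x).
    by rewrite ler_norml => /andP[? ?]; apply/andP; split; lra.
  apply: (nneseries_ge_term (f := fun i =>
    mscale (NngNum (w0 i)) (mrestr lebesgue (mV i)) (cyl (word t j)))) => n.
  exact: measure_ge0.
have G1 : 1 <= 4 `^ dl :> R by rewrite -[leLHS](powRr0 4) ler_powR// ler1n.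
suff : K j <= w i by rewrite leNgt key.
apply: le_trans (K_le j) _; case: j jd jmin {key} => [|m] _ jmin.
  rewrite expr0 -[leLHS]mulr1; apply: ler_pM => //.
  by rewrite -[leLHS](powRr0 (d i)) ger_powR ?d0// oppr_le0.
rewrite exprS ler_pM2l ?powR_gt0//.
have dm : d i < 4 ^- m.
  by rewrite ltNge; apply/negP => /jmin; rewrite ltnn.
rewrite -powR_mulrn ?powR_ge0// -powRrM mulrC powRrM powR_mulrn// powRN.
rewrite -[leLHS]invrK lef_pV2 ?posrE ?invr_gt0 ?powR_gt0 ?exprn_gt0//.
rewrite -powRN -[- dl]mulN1r powRrM powR_inv1 ?exprn_ge0//.
by apply: ge0_ler_powR; rewrite ?nnegrE ?invr_ge0 ?exprn_ge0// ltW.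
Qed.

End Path.

(** * Free blocks followed by forced words *)

Section Insertion.
Context {R : realType}.
Variables (A B : nat) (on : nat -> bool) (M D : nat -> nat).
Hypothesis D_gt2 : forall j, (2 < D j)%N.

Definition inserted j := if on j then ins (M j) (D j) else [::].

Definition extension j (t : 'I_A.+1 * 'I_B) := block t.1 t.2 ++ inserted j.

Definition cost j : R := if on j then (D j * (M j).+2)%:R ^+ 2 else 1.

Lemma closing_block a b : closing (block a b).
Proof. by rewrite /closing /block digits_rcons digits_nseq2 last_rcons. Qed.

Lemma digits_inserted j : digits (inserted j).
Proof.
by rewrite /inserted; case: ifP => // _; rewrite digits_rcons digits_nseq2 (ltnW (D_gt2 j)).
Qed.

Lemma extension_closing j t : closing (extension j t).
Proof.
rewrite /extension /inserted; case: ifP => _; last by rewrite cats0 closing_block.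
rewrite /closing last_cat last_rcons D_gt2 andbT digits_cat.
have /andP[-> _] := closing_block t.1 t.2.
by rewrite digits_rcons digits_nseq2 (ltnW (D_gt2 j)).
Qed.

(** After [w], the first digit of [x] other than 2 reveals [a] by its position and [b] by its
    value. *)
Lemma extension_inj j w t u (x : R) : digits w ->
  cyl (w ++ extension j t) x -> cyl (w ++ extension j u) x -> t = u.
Proof.
move=> wd; rewrite /extension !catA.
have prefix a b : cyl ((w ++ block a b) ++ inserted j) x ->
    w ++ block a b = mkseq (fun k => bcf_digit k.+1 x) (size w + a.+1)%N.
  have bd : digits (w ++ block a b).
    by rewrite digits_cat wd; have /andP[] := closing_block a b.
  move=> /(cyl_cat _); rewrite digits_cat bd digits_inserted => /(_ isT).
  by move=> /(cyl_digits bd)[_]; rewrite size_cat size_rcons size_nseq.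
have digit a b k : cyl ((w ++ block a b) ++ inserted j) x -> (k <= a)%N ->
    bcf_digit (size w + k).+1 x = (if k == a then b.+3 else 2)%N.
  move=> /prefix E ka; have := congr1 (fun s => nth 0%N s (size w + k)%N) E.
  rewrite nth_mkseq ?ltn_add2l// => <-.
  rewrite nth_cat ltnNge leq_addr/= addKn nth_rcons size_nseq.
  by case: ltngtP ka => // ka _; rewrite nth_nseq ka.
case: t u => [a b] [a' b'] /= h h'.
have aa : a = a' :> nat.
  case: (ltngtP a a') => // lt.
    by have := digit _ _ _ h' (ltnW lt); rewrite (digit _ _ _ h (leqnn _)) eqxx (ltn_eqF lt).
  by have := digit _ _ _ h (ltnW lt); rewrite (digit _ _ _ h' (leqnn _)) eqxx (ltn_eqF lt).
have := digit _ _ _ h (leqnn _); rewrite {1}aa (digit _ _ _ h' (leqnn _)) !eqxx => -[bb].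
by congr (_, _); apply: val_inj.
Qed.

(** A bound for the proportion of length that one free block loses. *)
Let eta : R := 2 / A.+2%:R + 2 * A.+1%:R / B.+2%:R.

Hypothesis eta_lt1 : eta < 1.

Let K j : R := (1 - eta)^-1 ^+ j * \prod_(i < j) cost i.

Lemma cost_ge1 j : 1 <= cost j.
Proof.
rewrite /cost; case: ifP => // _; rewrite exprn_ege1// ler1n muln_gt0.
by have := D_gt2 j; case: (D j).
Qed.

Lemma K_step j w : full w ->
  K j * len w <= K j.+1 * \sum_t len (w ++ extension j t).
Proof.
move=> wf; have wd : digits w by case/andP: wf.
have c1 := cost_ge1 j.
have ins_le (a : 'I_A.+1) (b : 'I_B) :
    len (w ++ block a b) <= cost j * len (w ++ extension j (a, b)) :> R.
  rewrite /extension /cost /inserted; case: ifP => _; last by rewrite cats0 mul1r.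
  by rewrite catA; apply: ins_cost => //; apply: full_cat => //; exact: closing_block.
have : (1 - eta) * len w <= cost j * \sum_t len (w ++ extension j t) :> R.
  rewrite /eta opprD addrA; apply: (le_trans (sum_len_blocks A B wf)).
  rewrite pair_big/= mulr_sumr; apply: ler_sum => -[a b] _; exact: ins_le.
have e0 : 0 < 1 - eta by rewrite subr_gt0.
rewrite mulrC -ler_pdivlMr// => step.
have K0 : 0 <= K j.
  rewrite /K mulr_ge0 ?exprn_ge0 ?invr_ge0 ?(ltW e0)//.
  by apply: prodr_ge0 => i _; apply: le_trans (cost_ge1 i).
have -> : K j.+1 = K j * ((1 - eta)^-1 * cost j).
  by rewrite /K big_ord_recr/= exprSr; ring.
rewrite -mulrA ler_wpM2l// (le_trans step)// le_eqVlt; apply/orP; left; apply/eqP.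
by ring.
Qed.

Lemma hausdorff_insertion_neq0 (s : R) (E : set R) : 0 <= s < 1 ->
  (1 - eta)^-1 <= 2 `^ ((1 - s) / 2) ->
  (forall j, \prod_(i < j) cost i <= (2 `^ ((1 - s) / 2)) ^+ j) ->
  (forall t x, (forall j, cyl (word extension t j) x) -> E x) ->
  hausdorff_measure s E != 0.
Proof.
move=> /andP[s0 s1] le_eta le_cost pathE; apply/eqP => E0.
(* Free blocks and forced words each contribute at most [2^dl] per step to [K], hence [4^dl]
   together, and the exponent [1 - dl] is still at least [s]. *)
set dl := (1 - s) / 2 in le_eta le_cost.
have dl0 : 0 <= dl by rewrite /dl; lra.
have K_le j : K j <= (4 `^ dl) ^+ j.
  rewrite (_ : 4 = 2 * 2 :> R); last by ring.
  rewrite powRM// exprMn; apply: ler_pM => //.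
  - by rewrite exprn_ge0// invr_ge0 subr_ge0 ltW.
  - by apply: prodr_ge0 => i _; apply: le_trans (cost_ge1 i).
  - by rewrite lerXn2r ?nnegrE ?powR_ge0// invr_ge0 subr_ge0 ltW.
have c0 : 0 < (4 * 4 `^ dl)^-1 :> R by rewrite invr_gt0 mulr_gt0// powR_gt0.
have [||U [d [EU d01 Ud thin]]] := @hausdorff_null_cover R s (1 - dl) _ E s0 _ _ c0 E0.
- by rewrite /dl; lra.
- by rewrite /dl; lra.
have K0 : K 0 = 1 by rewrite /K big_ord0 mulr1.
have [t [x [xP xU]]] :=
  avoid_cover extension_closing extension_inj K_step dl0 K0 K_le d01 Ud thin.
by have /EU[i _ /xU] := pathE t x xP.
Qed.

End Insertion.

(** * Sparse insertions *)

(** Take the largest [k <= j] with [F k <= j]. The maximum of the empty family is 0, which accounts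
    for the term [F 0]. *)
Lemma slow_reindexing (F : nat -> nat) : exists kappa : nat -> nat,
  (forall j, (F (kappa j) <= j + F 0)%N) /\
  forall k, exists i, forall j, (i <= j)%N -> (k <= kappa j)%N.
Proof.
exists (fun j => \max_(k < j.+1 | (F k <= j)%N) (k : nat)); split => [j|k].
  have [/existsP[k Fk]|none] := boolP [exists k : 'I_j.+1, (F k <= j)%N].
    have [i Fi ->] := @eq_bigmax_cond _ (fun k : 'I_j.+1 => F k <= j)%N
      (fun k : 'I_j.+1 => k : nat) ltac:(by apply/card_gt0P; exists k).
    exact: leq_trans Fi (leq_addr _ _).
  rewrite big_pred0 ?leq_addl// => k.
  by apply/negbTE; move: none; rewrite negb_exists => /forallP /(_ k).
exists (maxn k (F k)) => j; rewrite geq_max => /andP[kj Fk].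
exact: (@leq_bigmax_cond _ (fun k : 'I_j.+1 => F k <= j)%N
  (fun k : 'I_j.+1 => k : nat) (Ordinal (kj : k < j.+1)%N)).
Qed.

Section Schedule.
Context {R : realType}.
Variables (g Gam : R) (c gain : nat -> R).
Hypothesis g_gt1 : 1 < g.
Hypothesis g_le16 : g <= 16.
Hypothesis Gam_ge1 : 1 <= Gam.
Hypothesis c_ge4 : forall j, 4 <= c j.
Hypothesis c_le : forall j, c j ^+ 2 <= Gam * g ^+ j.

(* Greedy schedule for inserting, at time [j], a word of cost [c j]. *)
Fixpoint spent j : R :=
  if j is i.+1 then spent i * (if spent i * c i <= g ^+ i then c i else 1) else 1.

Definition affordable j := spent j * c j <= g ^+ j.

Lemma spent_prod j : spent j = \prod_(i < j) (if affordable i then c i else 1).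
Proof. by elim: j => [|j IH]; rewrite ?big_ord0// big_ord_recr/= -IH. Qed.

Lemma spent_ge1 j : 1 <= spent j.
Proof.
elim: j => //= j IH; case: ifP => _; last by rewrite mulr1.
by have c4 := c_ge4 j; rewrite (le_trans IH)// ler_peMr; lra.
Qed.

Lemma spent_le j : spent j <= g ^+ j.
Proof.
elim: j => //= j IH; have gj : g ^+ j <= g ^+ j.+1 by rewrite ler_eXn2l.
by case: ifP => [h|_]; rewrite ?mulr1; exact: le_trans gj.
Qed.

(** The greedy schedule spends at least about the square root of its budget. If a word is refused,
    [g^j < spent j * c j], and squaring with [c_le] gives the bound; if it is accepted, the square
    grows by [c j ^ 2 >= 16 >= g]. *)
Lemma spent_ge j : g ^+ j <= Gam * g * spent j ^+ 2.
Proof.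
elim: j => [|j IH]; first by rewrite expr0 expr1n mulr1 mulr_ege1// ltW.
rewrite /=; have s1 := spent_ge1 j; have c4 := c_ge4 j; have cG := c_le j.
have g0 : 0 < g by rewrite (lt_trans ltr01).
have gj1 : 0 < g ^+ j by rewrite exprn_gt0.
case: ifP => [_|/negbT]; last first.
  rewrite -ltNge mulr1 => lt.
  have s0 : 0 < spent j by lra.
  have lt2 : g ^+ j * g ^+ j < spent j ^+ 2 * (Gam * g ^+ j).
    apply: (@lt_le_trans _ _ ((spent j * c j) ^+ 2)); first by rewrite expr2 ltr_pM// ltW.
    by rewrite exprMn ler_wpM2l// sqr_ge0.
  have : g ^+ j < spent j ^+ 2 * Gam by rewrite -(ltr_pM2r gj1) -mulrA.
  by move/ltW => h; rewrite [g ^+ j.+1]exprS (mulrC Gam) -[leRHS]mulrA ler_pM2l// [leRHS]mulrC.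
have c16 : 16 <= c j ^+ 2 by rewrite expr2; nra.
rewrite exprMn exprS mulrA.
apply: (@le_trans _ _ (16 * g ^+ j)); first by rewrite ler_pM2r.
by rewrite mulrC; apply: ler_pM => //; exact: ltW.
Qed.

Hypothesis gain_ge0 : forall j, 0 <= gain j.
Hypothesis gain_ge : forall k, exists i, forall j, (i <= j)%N ->
  k%:R * ln (c j) <= gain j.

(** From some time on, each accepted word gains [k'] times the logarithm of its cost, so the total
    gain is at least [k' ln (spent j)] up to a constant, and [spent_ge] bounds this below linearly
    in [j]. The factor 4 in [k'] gives twice the desired slope, which absorbs the constants. *)
Lemma schedule_gain (k : nat) : exists i, forall j, (i <= j)%N ->
  k%:R * j%:R <= \sum_(i < j | affordable i) gain i.
Proof.
case: k => [|k]; first by exists 0%N => j _; rewrite mul0r sumr_ge0.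
have lg : 0 < ln g by rewrite ln_gt0.
pose k' := (Num.truncn (4 * k.+1%:R / ln g)).+1.
have [i0 i0P] := gain_ge k'.
pose Q := k'%:R * ln (spent i0).
have low j : (i0 <= j)%N -> k'%:R * ln (spent j) - Q <= \sum_(i < j | affordable i) gain i.
  elim: j => [|j IH].
    rewrite leqn0 => /eqP i00; rewrite /Q i00 subrr sumr_ge0//.
  rewrite leq_eqVlt => /predU1P[<-|]; first by rewrite /Q subrr sumr_ge0.
  rewrite ltnS => ij; rewrite big_mkcond big_ord_recr/= -big_mkcond/=.
  have {IH} := IH ij; have gj := i0P j ij; have s1 := spent_ge1 j.
  rewrite -/(affordable j); case: ifP => _; last by rewrite mulr1 addr0.
  have s0 : 0 < spent j by lra.
  have c0 : 0 < c j by have := c_ge4 j; lra.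
  by rewrite lnM ?posrE//; lra.
have Glg j : j%:R * ln g <= ln (Gam * g) + 2 * ln (spent j).
  have s0 : 0 < spent j by have := spent_ge1 j; lra.
  have g0 : 0 < g by rewrite (lt_trans ltr01).
  have Gg0 : 0 < Gam * g by rewrite mulr_gt0// (lt_le_trans ltr01).
  rewrite mulr_natl -lnXn// mulr_natl -lnXn// -lnM ?posrE ?exprn_gt0//.
  have S0 : 0 < Gam * g * spent j ^+ 2 by rewrite mulr_gt0// exprn_gt0.
  by rewrite ler_ln ?posrE ?exprn_gt0// spent_ge.
pose Q' := k'%:R * ln (Gam * g) / 2 + Q.
exists (maxn i0 (Num.truncn `|Q'|).+1) => j; rewrite geq_max => /andP[/low + Qj].
apply: le_trans.
have Qj' : Q' <= j%:R.
  have /andP[_ /ltW Q1] := truncn_itv (normr_ge0 Q').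
  by rewrite (le_trans (ler_norm _))// (le_trans Q1)// ler_nat.
have k'g : 4 * k.+1%:R <= k'%:R * ln g.
  rewrite -ler_pdivrMr//; apply: ltW.
  have p : 0 <= 4 * k.+1%:R / ln g by rewrite divr_ge0 ?mulr_ge0// ltW.
  by have /andP[] := truncn_itv p.
have k'0 : (0 : R) <= k'%:R by [].
have j0 : (0 : R) <= j%:R by [].
have h1 := ler_wpM2l k'0 (Glg j); have h2 := ler_wpM2r j0 k'g.
have h3 : j%:R <= k.+1%:R * j%:R :> R by rewrite ler_peMl// ler1n.
by rewrite /Q' in Qj'; lra.
Qed.

End Schedule.

(** * Sparse insertions that keep the dimension *)

Section Levels.
Context {R : realType}.

Lemma small_tail (e : R) : 0 < e -> exists A B : nat,
  2 / A.+2%:R + 2 * A.+1%:R / B.+2%:R <= e.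
Proof.
move=> e0.
have small (y : R) : 0 <= y -> exists n : nat, y / n.+2%:R <= e / 2.
  move=> y0; exists (Num.truncn (y / (e / 2))).
  have p0 : 0 <= y / (e / 2) by rewrite !divr_ge0// ltW.
  have /andP[_ /ltW h] := truncn_itv p0.
  rewrite ler_pdivrMr ?ltr0n// mulrC -ler_pdivrMr ?divr_gt0//.
  by rewrite (le_trans h)// ler_nat.
have [A hA] := small 2 ltac:(by []).
have [B hB] := small (2 * A.+1%:R) ltac:(by rewrite mulr_ge0).
by exists A, B; rewrite [leRHS](splitr e) lerD.
Qed.

(** The parameters of index [kappa j] are used at time [j], where [kappa] tends to infinity slowly
    enough to control both the cost of the words and [F]. *)
Lemma full_dimension_insertions (D M : nat -> nat) (gain F : nat -> R) (s : R) :
  0 <= s < 1 -> (forall k, 2 < D k)%N ->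
  (forall k, k%:R * ln ((D k * (M k).+2)%:R ^+ 2) <= gain k) ->
  exists (A B : nat) (on : nat -> bool) (kappa : nat -> nat) (C : R), [/\
    forall j, F (kappa j) <= C + j%:R,
    forall k : nat, exists i, forall j, (i <= j)%N ->
      k%:R * j%:R <= \sum_(i < j | on i) gain (kappa i) &
    forall E : set R, (forall t x,
      (forall j, cyl (word (@extension A B on (M \o kappa) (D \o kappa)) t j) x) -> E x) ->
    hausdorff_measure s E != 0].
Proof.
move=> s01 D2 gainP; have /andP[s0 s1] := s01.
pose g : R := 2 `^ ((1 - s) / 2).
have g1 : 1 < g.
  rewrite /g /powR pnatr_eq0/= expR_gt1 mulr_gt0 ?ln_gt0 ?ltr1n//; lra.
have g2 : g <= 2 by rewrite -[leRHS](@powRr1 _ 2)// ler_powR ?ler1n//; lra.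
pose c k : R := (D k * (M k).+2)%:R ^+ 2.
have c4 k : 4 <= c k.
  have : (2 <= D k * (M k).+2)%N by have := D2 k; nia.
  rewrite -(ler_nat R) => h; rewrite /c expr2 (_ : 4 = 2 * 2); last by ring.
  by apply: ler_pM.
have lg : 0 < ln g by rewrite ln_gt0.
(* The first summand dominates [F k]; the second makes [c k ^ 2 <= g ^ F' k], as the schedule
   requires. *)
pose F' k := ((Num.truncn `|F k|).+1 + (Num.truncn (2 * ln (c k) / ln g)).+1)%N.
have [kappa [kF klim]] := slow_reindexing F'.
pose Gam : R := g ^+ F' 0.
have Gam1 : 1 <= Gam by rewrite exprn_ege1// ltW.
have lc k : 0 <= ln (c k) by rewrite ln_ge0//; have := c4 k; lra.
have c_le : forall j, c (kappa j) ^+ 2 <= Gam * g ^+ j.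
  move=> j; rewrite /Gam -exprD; apply: (@le_trans _ _ (g ^+ F' (kappa j))); last first.
    by rewrite ler_eXn2l// addnC.
  have c0 : 0 < c (kappa j) by have := c4 (kappa j); lra.
  rewrite -ler_ln ?posrE ?(exprn_gt0 _ c0) ?exprn_gt0 ?(lt_trans ltr01)//.
  rewrite (lnXn _ c0) (lnXn _ (lt_trans ltr01 g1)).
  rewrite -[leRHS]mulr_natl -ler_pdivrMr// -[X in X / _]mulr_natl.
  have p0 : 0 <= 2 * ln (c (kappa j)) / ln g by rewrite divr_ge0 ?mulr_ge0// ltW.
  have /andP[_ /ltW h] := truncn_itv p0.
  by rewrite (le_trans h)// ler_nat leq_addl.
have gain0 j : 0 <= gain (kappa j).
  by apply: (le_trans _ (gainP _)); apply: mulr_ge0 => //; exact: lc.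
have gain_ge k : exists i, forall j, (i <= j)%N ->
    k%:R * ln (c (kappa j)) <= gain (kappa j).
  have [i ik] := klim k; exists i => j /ik kj.
  by apply: (le_trans _ (gainP _)); apply: ler_wpM2r; rewrite ?ler_nat//; exact: lc.
(* A loss of at most [1 - 1/g] per free block keeps [(1 - eta)^-1 <= g]. *)
have e0 : 0 < 1 - g^-1 by rewrite subr_gt0 invf_lt1// (lt_trans ltr01).
have [A [B AB]] := small_tail e0.
pose on := affordable g (c \o kappa).
exists A, B, on, kappa, (F' 0%N)%:R; split.
- move=> j; rewrite (le_trans (ler_norm _))// -natrD.
  have /andP[_ /ltW h] := truncn_itv (normr_ge0 (F (kappa j))).
  by rewrite (le_trans h)// ler_nat addnC (leq_trans _ (kF j))// leq_addr.
- have g16 : g <= 16 by lra.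
  exact: (schedule_gain g1 g16 Gam1 (fun j => c4 (kappa j)) c_le gain0 gain_ge).
- move=> E EP; apply: (@hausdorff_insertion_neq0 R A B on (M \o kappa) (D \o kappa)) => //.
  + by move=> j; exact: D2.
  + by apply: (le_lt_trans AB); rewrite gtrBl invr_gt0 (lt_trans ltr01).
  + have gV : 0 < g^-1 by rewrite invr_gt0 (lt_trans ltr01).
    have gE : g^-1 <= 1 - (2 / A.+2%:R + 2 * A.+1%:R / B.+2%:R).
      by move: AB; rewrite !lerBrDr addrC.
    by rewrite -/g -[leRHS]invrK lef_pV2 ?posrE// (lt_le_trans gV).
  + move=> j; have := @spent_le R g (c \o kappa) g1 j.
    by rewrite spent_prod.
Qed.

End Levels.

(** * Birkhoff sums along a path *)

Section PathMeans.
Context {R : realType}.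
Variables (A B : nat) (on : nat -> bool) (M D : nat -> nat).
Hypothesis D_gt2 : forall j, (2 < D j)%N.
Variables (t : nat -> 'I_A.+1 * 'I_B) (x : R).
Local Notation W := (word (@extension A B on M D) t).
Local Notation ext j := (@extension A B on M D j (t j)).
Hypothesis xW : forall j, cyl (W j) x.

Let dig k := bcf_digit k.+1 x.

Let W_closing j u : closing (@extension A B on M D j u).
Proof. exact: extension_closing. Qed.

Lemma path_itv : 0 <= x < 1.
Proof. by have [] := cyl_digits (digits_word W_closing t 0) (xW 0). Qed.

Lemma path_mkseq j : W j = mkseq dig (size (W j)).
Proof. by have [] := cyl_digits (digits_word W_closing t j) (xW j). Qed.

Lemma path_sum (V : zmodType) (h : nat -> V) j :
  \sum_(0 <= k < size (W j)) h (dig k) = \sum_(b <- W j) h b.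
Proof.
by rewrite [in RHS]path_mkseq /mkseq big_map /index_iota subn0.
Qed.

Lemma size_pathS j : size (W j.+1) = (size (W j) + size (ext j))%N.
Proof. by rewrite /= size_cat. Qed.

Lemma path_sum_ext (V : zmodType) (h : nat -> V) j :
  \sum_(size (W j) <= k < size (W j.+1)) h (dig k) = \sum_(b <- ext j) h b.
Proof.
have le : (size (W j) <= size (W j.+1))%N by rewrite size_pathS leq_addr.
have : \sum_(0 <= k < size (W j.+1)) h (dig k) = \sum_(0 <= k < size (W j)) h (dig k) +
    \sum_(size (W j) <= k < size (W j.+1)) h (dig k) by exact: big_cat_nat.
by rewrite !path_sum /= big_cat/= => /addrI.
Qed.

Lemma size_ext_gt0 j : (0 < size (ext j))%N.
Proof. by rewrite lt0n size_eq0; apply: ext_nonnil. Qed.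

Lemma size_path_ge j : (j <= size (W j))%N.
Proof.
elim: j => // j IH; rewrite size_pathS.
by apply: leq_trans (leq_add IH (size_ext_gt0 j)); rewrite addn1.
Qed.

Lemma size_path_le i j : (i <= j)%N -> (size (W i) <= size (W j))%N.
Proof.
move=> /subnK <-; elim: (j - i)%N => // n IH.
by rewrite addSn size_pathS (leq_trans IH)// leq_addr.
Qed.

Lemma path_locate J n : (size (W J) <= n)%N ->
  exists j, [/\ (J <= j)%N, (size (W j) <= n)%N & (n < size (W j.+1))%N].
Proof.
move=> Jn; have ex : exists j, (n < size (W j.+1))%N.
  by exists n; apply: size_path_ge.
have [j nj jmin] := ex_minnP ex; exists j.
have jn : (size (W j) <= n)%N.
  case: j nj jmin => // j nj jmin; rewrite leqNgt; apply/negP => /jmin.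
  by rewrite ltnn.
split => //; rewrite leqNgt; apply/negP => jJ.
by have := leq_trans nj (leq_trans (size_path_le jJ) Jn); rewrite ltnn.
Qed.

Lemma sum_block (V : zmodType) (h : nat -> V) a b :
  \sum_(c <- block a b) h c = h 2%N *+ a + h b.+3.
Proof. by rewrite /block -cats1 big_cat big_seq1 big_nseq iter_addr_0. Qed.

Lemma sum_inserted (V : zmodType) (h : nat -> V) j :
  \sum_(c <- inserted on M D j) h c =
    if on j then h 2%N *+ M j + h (D j) else 0.
Proof.
rewrite /inserted; case: ifP => _; last by rewrite big_nil.
by rewrite /ins -cats1 big_cat big_seq1 big_nseq iter_addr_0.
Qed.

Lemma sum_ext (V : zmodType) (h : nat -> V) j : \sum_(c <- ext j) h c =
  h 2%N *+ (t j).1 + h (t j).2.+3 + if on j then h 2%N *+ M j + h (D j) else 0.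
Proof. by rewrite big_cat sum_block sum_inserted. Qed.

(** Every nonempty [W j] ends with a digit at least 3, so such digits occur arbitrarily late. *)
Lemma path_irrational : irrational x.
Proof.
apply: irrational_digits path_itv _ => n.
have /andP[_] := full_word W_closing t n.+1; have := size_path_ge n.+1.
rewrite path_mkseq size_mkseq; move: (size _) => [//|m] nm.
rewrite mkseqS last_rcons => m3; exists m => // m2.
by move: m3; rewrite /dig m2.
Qed.

Lemma size_path_sum j :
  (\sum_(i < j | on i) M i <= size (W j))%N.
Proof.
elim: j => [|j IH]; first by rewrite big_ord0.
rewrite size_pathS big_mkcond big_ord_recr/= -big_mkcond leq_add//.
rewrite /extension size_cat /inserted; case: ifP => // _.
by rewrite [size (ins _ _)]size_rcons size_nseq; lia.
Qed.

Let block_bound (h : nat -> R) : R := A.+1%:R * \sum_(b < B.+3) `|h b|.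

Lemma norm_block_le (h : nat -> R) (u : 'I_A.+1 * 'I_B) :
  `|h 2%N| *+ u.1 + `|h u.2.+3| <= block_bound h.
Proof.
have hb b : (b < B.+3)%N -> `|h b| <= \sum_(b < B.+3) `|h b|.
  by move=> bB; rewrite (bigD1 (Ordinal bB))//= lerDl sumr_ge0.
have h0 : 0 <= \sum_(b < B.+3) `|h b| by rewrite sumr_ge0.
rewrite /block_bound -natr1 mulrDl mul1r lerD//; last by apply: hb; rewrite !ltnS.
rewrite -[leLHS]mulr_natl; apply: ler_pM => //; first by rewrite ler_nat -ltnS.
exact: hb.
Qed.

Lemma norm_ext_le (h : nat -> R) j C :
  (on j -> `|h (D j) + (M j)%:R * h 2%N| <= C) -> 0 <= C ->
  `|\sum_(c <- ext j) h c| <= block_bound h + C.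
Proof.
move=> hC C0; rewrite sum_ext (le_trans (ler_normD _ _))// lerD//.
  rewrite (le_trans (ler_normD _ _))// normrMn; exact: norm_block_le.
by case: ifP => [/hC|]; rewrite ?normr0// addrC mulr_natl.
Qed.

(** [C] bounds the net contribution of a forced word and [C' + j] the partial sums inside the [j]-th
    one. The last assumption makes [n] superlinear in the number [j] of completed extensions, so the
    sum is [O(j) = o(n)]. *)
Lemma path_sum_small (h : nat -> R) (C C' : R) :
  (forall j, `|h (D j) + (M j)%:R * h 2%N| <= C) ->
  (forall j, `|h (D j)| + (M j)%:R * `|h 2%N| <= C' + j%:R) ->
  (forall k : nat, exists i, forall j, (i <= j)%N ->
     k%:R * j%:R <= \sum_(i < j | on i) (M i)%:R :> R) ->
  forall e, 0 < e -> exists N, forall n, (N <= n)%N ->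
    `|\sum_(0 <= k < n) h (dig k)| <= e * n%:R.
Proof.
move=> hC hC' grow e e0.
have C0 : 0 <= C by apply: le_trans (hC 0%N).
have b0 : 0 <= block_bound h by rewrite mulr_ge0// sumr_ge0.
have atW j : `|\sum_(0 <= k < size (W j)) h (dig k)| <= j%:R * (block_bound h + C).
  rewrite path_sum; elim: j => [|j IH]; first by rewrite big_nil normr0 mul0r.
  rewrite /= big_cat/= (le_trans (ler_normD _ _))// -natr1 mulrDl mul1r lerD//.
  exact: norm_ext_le.
pose Z := block_bound h + C + `|C'| + 1.
have [J JP] := grow (Num.truncn (3 * Z / e)).+1.
exists (size (W (maxn J 1))) => n /path_locate[j [+ jn nj]].
rewrite geq_max => /andP[Jj j1].
have split_sum : `|\sum_(0 <= k < n) h (dig k)| <=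
    j%:R * (block_bound h + C) + (block_bound h + (C' + j%:R)).
  rewrite (@big_cat_nat _ _ _ (size (W j)))//= (le_trans (ler_normD _ _))// lerD//.
  apply: (le_trans (ler_norm_sum _ _ _)).
  apply: (@le_trans _ _ (\sum_(size (W j) <= k < size (W j.+1)) `|h (dig k)|)).
    by rewrite [leRHS](@big_cat_nat _ _ _ n)//= ?(ltnW nj)// lerDl sumr_ge0.
  rewrite (path_sum_ext (fun b => `|h b|)) sum_ext lerD//; first exact: norm_block_le.
  case: ifP => _; first by apply: (le_trans _ (hC' j)); rewrite addrC mulr_natl.
  by apply: (le_trans _ (hC' j)); rewrite addr_ge0// mulr_ge0.
have j1R : (1 : R) <= j%:R by rewrite ler1n.
have Lj : (Num.truncn (3 * Z / e)).+1%:R * j%:R <= n%:R :> R.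
  apply: (le_trans (JP j Jj)); rewrite -natr_sum ler_nat.
  exact: leq_trans (size_path_sum j) jn.
have Z0 : 0 <= 3 * Z / e by rewrite divr_ge0 ?(ltW e0)// mulr_ge0// /Z !addr_ge0.
have /andP[_ /ltW Zk] := truncn_itv Z0.
rewrite (le_trans split_sum)//.
have e3 : 3 * Z * j%:R <= e * n%:R.
  move: Zk; rewrite ler_pdivrMr// => Zk.
  apply: (le_trans (ler_wpM2r (ler0n _ j) Zk)).
  by rewrite mulrAC mulrC ler_pM2l.
apply: le_trans e3; have := ler_norm C'; rewrite /Z.
move: (block_bound h) `|C'| b0 (normr_ge0 C') => b c b0 c0 Cc.
by nra.
Qed.

(** Without forced runs of 2, [n] is at most linear in [j], while the sum is superlinear in [j]. *)
Lemma path_sum_large (h : nat -> R) : (forall b, (2 <= b)%N -> 0 <= h b) ->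
  (forall j, M j = 0%N) ->
  (forall k : nat, exists i, forall j, (i <= j)%N ->
     k%:R * j%:R <= \sum_(i < j | on i) h (D i)) ->
  forall K, exists N, forall n, (N <= n)%N ->
    K * n%:R <= \sum_(0 <= k < n) h (dig k).
Proof.
move=> h0 M0 grow K.
have hdig k : 0 <= h (dig k) by apply/h0/bcf_digit_ge2/path_itv.
have atW j : \sum_(i < j | on i) h (D i) <= \sum_(0 <= k < size (W j)) h (dig k).
  rewrite path_sum; elim: j => [|j IH]; first by rewrite big_ord0 big_nil.
  rewrite /= big_cat/= big_mkcond big_ord_recr/= -big_mkcond lerD//.
  rewrite sum_ext M0 mulr0n add0r lerDr addr_ge0//; last exact: h0.
  by rewrite mulrn_wge0// h0.
have sizeW j : (size (W j) <= j * A.+2)%N.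
  elim: j => // j IH; rewrite size_pathS mulSn addnC leq_add//.
  rewrite /extension size_cat size_rcons size_nseq /inserted M0.
  by have := ltn_ord (t j).1; case: ifP => /=; lia.
have [J JP] := grow (Num.truncn (2 * A.+2%:R * `|K|)).+1.
exists (size (W (maxn J 1))) => n /path_locate[j [+ jn nj]].
rewrite geq_max => /andP[/JP Jj j1].
rewrite (@big_cat_nat _ _ _ (size (W j)))//=.
apply: (@le_trans _ _ (\sum_(0 <= k < size (W j)) h (dig k))); last first.
  by rewrite lerDl sumr_ge0.
apply: le_trans (atW j); apply: le_trans Jj.
have nj' : n%:R <= 2 * A.+2%:R * j%:R :> R.
  by rewrite -!natrM ler_nat (leq_trans (leq_trans (ltnW nj) (sizeW j.+1)))//; nia.
have K0 : 0 <= 2 * A.+2%:R * `|K| by rewrite !mulr_ge0.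
have /andP[_ /ltW Kk] := truncn_itv K0.
apply: (@le_trans _ _ (`|K| * n%:R)); first by rewrite ler_wpM2r// ler_norm.
apply: (@le_trans _ _ (`|K| * (2 * A.+2%:R * j%:R))); first by rewrite ler_wpM2l.
by rewrite mulrA ler_wpM2r// mulrC.
Qed.

End PathMeans.

(** * Level sets of full dimension *)

Section LevelSets.
Context {R : realType}.
Variable psi : nat -> R.

Lemma birkhoff_mean_sub (x a : R) n : (0 < n)%N ->
  birkhoff_mean psi x n - a = n%:R^-1 * \sum_(0 <= k < n) (psi (bcf_digit k.+1 x) - a).
Proof.
move=> n0; rewrite /birkhoff_mean big_add1/= sumrB mulrBr sumr_const_nat subn0.
by rewrite -[a *+ n]mulr_natl mulKf// pnatr_eq0 -lt0n.
Qed.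

(** Split off [ln c] and use [ln y <= y] at [y = (m + 2) / c], where [K / c <= 1/2]. *)
Lemma ln_le_linear (K : R) : 0 <= K -> exists m0 : nat, forall m : nat, (m0 <= m)%N ->
  K * ln m.+2%:R <= m%:R.
Proof.
move=> K0; pose c := 2 * K + 1.
have c0 : 0 < c by rewrite /c; lra.
pose Q := 2 * (K * ln c + 1).
exists (Num.truncn `|Q|).+1 => m mQ.
have /andP[_ /ltW Q1] := truncn_itv (normr_ge0 Q).
have Qm : Q <= m%:R.
  by rewrite (le_trans (ler_norm _))// (le_trans Q1)// ler_nat.
have mc : 0 < (m.+2%:R / c : R) by rewrite divr_gt0.
have E : ln m.+2%:R = ln (m.+2%:R / c) + ln c :> R.
  by rewrite -lnM ?posrE// divfK// gt_eqF.
have L : ln (m.+2%:R / c) <= m.+2%:R / c by rewrite ltW// ln_sublinear.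
have KL : K * ln (m.+2%:R / c) <= m.+2%:R / 2.
  apply: (le_trans (ler_wpM2l K0 L)); rewrite mulrCA ler_wpM2l//.
  by rewrite ler_pdivrMr// /c; lra.
rewrite E mulrDr; move: KL Qm; rewrite /Q -[m.+2]addn2 natrD.
by lra.
Qed.

(** The deviations from [alpha] nearly cancel within each word [2^M D], and its number [M] of digits
    2 serves as the gain of the schedule. *)
Lemma level_set_pos (alpha C : R) (s : R) : 0 <= s < 1 ->
  (forall k : nat, exists DM : nat * nat, [/\ (2 < DM.1)%N,
    `|psi DM.1 - alpha + DM.2%:R * (psi 2%N - alpha)| <= C &
    k%:R * ln ((DM.1 * DM.2.+2)%:R ^+ 2) <= DM.2%:R :> R]) ->
  hausdorff_measure s (mean_level_set psi alpha%:E) != 0%E.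
Proof.
move=> s01 /choice[f fP]; pose h b := psi b - alpha.
pose D k := (f k).1; pose M k := (f k).2.
have D2 k : (2 < D k)%N by have [] := fP k.
have [|A [B [on [kappa [C' [FP grow pos]]]]]] := @full_dimension_insertions R D M
    (fun k => (M k)%:R) (fun k => `|h (D k)| + (M k)%:R * `|h 2%N|) s s01 D2.
  by move=> k; have [] := fP k.
apply: pos => t x xP.
have D2' j : (2 < (D \o kappa) j)%N by exact: D2.
have irr := path_irrational D2' xP; have /andP[x0 x1] := path_itv D2' xP.
split => //.
  rewrite x1 andbT lt_neqAle x0 andbT; apply/eqP => x00; apply: irr.
  by exists 0 => //; rewrite rmorph0.
apply/fine_cvgP; split; first by apply: nearW.
apply/cvgrPdist_le => e e0.
have [N NP] := path_sum_small D2' xP (h := h) (C := C) (C' := C')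
  (fun j => ltac:(by have [] := fP (kappa j))) FP grow e0.
exists (maxn N 1) => // n /=; rewrite geq_max => /andP[/NP Nn n1].
rewrite distrC birkhoff_mean_sub// normrM normfV normr_nat ler_pdivrMl ?ltr0n//.
by rewrite mulrC.
Qed.

(** The digit 2 deviates by 0 here, so a digit 3 can follow an arbitrarily long run of 2. *)
Lemma level_set_min_pos (s : R) : 0 <= s < 1 ->
  hausdorff_measure s (mean_level_set psi (psi 2%N)%:E) != 0%E.
Proof.
move=> s01; apply: (@level_set_pos _ `|psi 3%N - psi 2%N|) => // k.
have [|m0 mP] := @ln_le_linear (4 * k%:R); first by rewrite mulr_ge0.
pose M := maxn m0 1; exists (3%N, M); split => //=.
  by rewrite subrr mulr0 addr0.
apply: le_trans (mP M (leq_maxl _ _)).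
rewrite lnXn ?ltr0n// (mulrC 4) -mulrA ler_wpM2l// -[leLHS]mulr_natl.
have : ln (3 * M.+2)%:R <= 2 * ln M.+2%:R :> R.
  rewrite mulr_natl -lnXn ?ltr0n// ler_ln ?posrE ?exprn_gt0 ?ltr0n//.
  by rewrite -natrX ler_nat expnS expn1 leq_mul2r !ltnS leq_maxr orbT.
by lra.
Qed.

(** The forced words are single digits; [D * 2] is [D * M.+2] at [M = 0]. *)
Lemma infinite_level_set_pos (s : R) : 0 <= s < 1 ->
  (forall b, (2 <= b)%N -> psi 2%N <= psi b) ->
  (forall k : nat, exists2 D : nat, (2 < D)%N &
    k%:R * ln ((D * 2)%:R ^+ 2) <= psi D - psi 2%N) ->
  hausdorff_measure s (mean_level_set psi +oo%E) != 0%E.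
Proof.
move=> s01 psi2 Dex; have /choice[D DD] : forall k : nat, exists D : nat, (2 < D)%N /\
    k%:R * ln ((D * 2)%:R ^+ 2) <= psi D - psi 2%N.
  by move=> k; have [D D2 DP] := Dex k; exists D.
have D2 k : (2 < D k)%N by have [] := DD k.
have DP k : k%:R * ln ((D k * 2)%:R ^+ 2) <= psi (D k) - psi 2%N by have [] := DD k.
pose h b := psi b - psi 2%N.
have [A [B [on [kappa [C' [_ grow pos]]]]]] := @full_dimension_insertions R D (fun=> 0%N)
    (fun k => h (D k)) (fun=> 0) s s01 D2 DP.
apply: pos => t x xP.
have D2' j : (2 < (D \o kappa) j)%N by exact: D2.
have irr := path_irrational D2' xP; have /andP[x0 x1] := path_itv D2' xP.
split => //.
  rewrite x1 andbT lt_neqAle x0 andbT; apply/eqP => x00; apply: irr.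
  by exists 0 => //; rewrite rmorph0.
apply/cvgeyPge => K.
have h0 b : (2 <= b)%N -> 0 <= h b by move=> /psi2; rewrite subr_ge0.
have [N NP] := path_sum_large D2' xP h0 (fun=> erefl) grow (K - psi 2%N).
exists (maxn N 1) => // n /=; rewrite geq_max => /andP[/NP Nn n1].
rewrite lee_fin -(lerD2r (- psi 2%N)) birkhoff_mean_sub// ler_pdivlMl ?ltr0n//.
by rewrite mulrC.
Qed.

Hypothesis psi_fast : (psi n / ln n%:R)%:E @[n --> \oo] --> +oo%E.

Lemma fast_exists (K : R) : exists n : nat,
  [/\ (2 < n)%N, 1 <= ln n%:R :> R & K * ln n%:R <= psi n].
Proof.
have /cvgeyPge/(_ K)[N _ NP] := psi_fast.
pose n := maxn N (maxn 3 (Num.truncn (expR (1 : R))).+1).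
have n3 : (2 < n)%N by rewrite /n !leq_max orbT.
have n1 : 1 <= ln n%:R :> R.
  have n0 : (0 < n)%N by lia.
  rewrite -[leLHS](@expRK R) ler_ln ?posrE ?expR_gt0 ?ltr0n//.
  have /andP[_ /ltW h] := truncn_itv (ltW (expR_gt0 (1 : R))).
  by rewrite (le_trans h)// ler_nat /n !leq_max leqnn !orbT.
exists n; split => //; have := NP n (leq_maxl _ _); rewrite /= lee_fin.
by rewrite ler_pdivlMr// (lt_le_trans ltr01).
Qed.

Lemma insertion_params (alpha : R) : psi 2%N < alpha ->
  exists C : R, forall k : nat, exists DM : nat * nat, [/\ (2 < DM.1)%N,
    `|psi DM.1 - alpha + DM.2%:R * (psi 2%N - alpha)| <= C &
    k%:R * ln ((DM.1 * DM.2.+2)%:R ^+ 2) <= DM.2%:R :> R].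
Proof.
move=> lt; pose a := alpha - psi 2%N; have a0 : 0 < a by rewrite subr_gt0.
exists a => k; have k0 : (0 : R) <= k%:R by [].
have [|m0 mP] := @ln_le_linear (4 * k%:R); first by rewrite mulr_ge0.
(* This makes [(psi D - alpha) / a] at least [4 k ln D + m0 + 1]. Its integer part [M] then exceeds
   both [4 k ln D] and [4 k ln (M + 2)], and the remainder of the division is below [a], the chosen
   [C]. *)
have [D [D3 D1 DP]] := fast_exists (4 * k%:R * a + `|alpha| + a * m0.+1%:R).
have big : 4 * k%:R * ln D%:R + m0.+1%:R <= (psi D - alpha) / a.
  rewrite ler_pdivlMr//.
  have na := ler_norm alpha; have na0 := normr_ge0 alpha.
  have am : 0 <= a * m0.+1%:R by rewrite mulr_ge0// ltW.
  have : (`|alpha| + a * m0.+1%:R) * 1 <= (`|alpha| + a * m0.+1%:R) * ln D%:R.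
    by rewrite ler_wpM2l// addr_ge0.
  by move: DP; lra.
have lD : 0 <= ln D%:R :> R by lra.
have kl : 0 <= 4 * k%:R * ln D%:R :> R by rewrite mulr_ge0// mulr_ge0.
have p0 : 0 <= (psi D - alpha) / a.
  by apply: le_trans big; rewrite addr_ge0.
have /andP[M1 M2] := truncn_itv p0.
set M := Num.truncn _ in M1 M2.
have [MD Mm] : 4 * k%:R * ln D%:R <= M%:R :> R /\ (m0 <= M)%N.
  have h : 4 * k%:R * ln D%:R + m0%:R <= M%:R :> R.
    by move: (le_lt_trans big M2); rewrite -!natr1; lra.
  split; first by have : (0 : R) <= m0%:R by []; lra.
  by rewrite -(ler_nat R); lra.
exists (D, M); split => //=.
  move: M1 M2; rewrite ler_pdivlMr// ltr_pdivrMr// -natr1 mulrDl mul1r.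
  rewrite -[psi 2%N - alpha]opprB -/a mulrN => M1 M2.
  by rewrite ler_norml; apply/andP; split; lra.
have D0 : (0 < D)%N by lia.
rewrite natrM exprMn lnM ?posrE ?exprn_gt0 ?ltr0n//.
rewrite !lnXn ?ltr0n//.
have := mP M Mm.
have -> (u v : R) : k%:R * (u *+ 2 + v *+ 2) = 2 * k%:R * u + 2 * k%:R * v.
  by rewrite -[u *+ 2]mulr_natl -[v *+ 2]mulr_natl; ring.
by lra.
Qed.

Lemma digit_params (k : nat) : exists2 D : nat, (2 < D)%N &
  k%:R * ln ((D * 2)%:R ^+ 2) <= psi D - psi 2%N.
Proof.
have [D [D3 D1 DP]] := fast_exists (4 * k%:R + `|psi 2%N|).
exists D => //; have D0 : (0 < D)%N by lia.
have lnD : ln (D * 2)%:R <= 2 * ln D%:R :> R.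
  rewrite mulr_natl -lnXn ?ltr0n// ler_ln ?posrE ?exprn_gt0 ?ltr0n ?muln_gt0 ?D0//.
  by rewrite -natrX ler_nat; nia.
rewrite lnXn ?ltr0n ?muln_gt0 ?D0// -[_ *+ 2]mulr_natl.
have k0 : (0 : R) <= k%:R by [].
have h1 := ler_wpM2l k0 lnD; have h2 := ler_norm (psi 2%N).
have h3 : `|psi 2%N| * 1 <= `|psi 2%N| * ln D%:R by rewrite ler_wpM2l.
by lra.
Qed.

End LevelSets.

(** * Level sets of small dimension *)

Section WordSums.
Context {R : realType}.

Lemma sum_uniq_subset (T : eqType) (s r : seq T) (F : T -> R) :
  (forall x, 0 <= F x) -> uniq s -> {subset s <= r} ->
  \sum_(x <- s) F x <= \sum_(x <- r) F x.
Proof.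
move=> F0; elim: s r => [|x s IH] r /=; first by rewrite big_nil sumr_ge0.
move=> /andP[xs us] sr; have xr : x \in r by apply: sr; rewrite mem_head.
rewrite big_cons (perm_big _ (perm_to_rem xr)) big_cons lerD2l IH// => y ys.
have := sr y; rewrite in_cons ys orbT => /(_ isT).
rewrite (perm_mem (perm_to_rem xr)) in_cons => /predU1P[yx|//].
by move: xs; rewrite -yx ys.
Qed.

Fixpoint words (s : seq nat) n : seq (seq nat) :=
  if n is m.+1 then [seq b :: w | b <- s, w <- words s m] else [:: [::]].

Lemma mem_words s n w : size w = n -> all (mem s) w -> w \in words s n.
Proof.
elim: n w => [|n IH] [|b w]//= [wn] /andP[bs ws].
by apply/allpairsP; exists (b, w); split => //; exact: IH.
Qed.

Lemma sum_words s n (h : nat -> R) :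
  \sum_(w <- words s n) \prod_(b <- w) h b = (\sum_(b <- s) h b) ^+ n.
Proof.
elim: n => [|n IH]; first by rewrite /= big_seq1 big_nil.
rewrite /= big_allpairs_dep/= exprS -IH mulr_suml; apply: eq_bigr => b _.
by rewrite mulr_sumr; apply: eq_bigr => w _; rewrite big_cons.
Qed.

Lemma geometric_tail (lam : R) m n : 0 <= lam < 1 ->
  \sum_(m <= i < n) lam ^+ i <= lam ^+ m / (1 - lam).
Proof.
move=> /andP[l0 l1]; have l2 : 0 < 1 - lam by rewrite subr_gt0.
rewrite ler_pdivlMr//; have [nm|mn] := leqP n m.
  by rewrite big_geq// mul0r exprn_ge0.
rewrite -(subnKC (ltnW mn)); elim: (n - m)%N => [|k IH].
  by rewrite addn0 big_geq// mul0r exprn_ge0.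
rewrite addnS big_nat_recr ?leq_addr//= mulrDl.
suff : \sum_(m <= i < m + k) lam ^+ i * (1 - lam) + lam ^+ (m + k) * (1 - lam) =
  lam ^+ m - lam ^+ (m + k.+1).
  by move=> E; rewrite mulr_suml E gerBl exprn_ge0.
elim: k {IH} => [|k IH].
  by rewrite addn0 big_geq// add0r addn1 exprSr; ring.
rewrite addnS big_nat_recr ?leq_addr//= IH (addnS m k.+1) !exprSr addnS exprSr.
by ring.
Qed.

(** Words of length [n] contribute at most the [n]-th power of the sum over digits, hence [lam^n];
    the lengths [n >= m] give a geometric tail. *)
Lemma sum_distinct_words (lam : R) (h : nat -> R) m (ws : seq (seq nat)) :
  0 <= lam < 1 -> (forall b, 0 <= h b) ->
  (forall B, \sum_(2 <= b < B) h b <= lam) ->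
  uniq ws -> all digits ws -> all (fun w => (m <= size w)%N) ws ->
  \sum_(w <- ws) \prod_(b <- w) h b <= lam ^+ m / (1 - lam).
Proof.
move=> l01 h0 hlam ws_uniq /allP wd /allP wm; have /andP[l0 l1] := l01.
pose S := (\max_(w <- ws) size w).+1.
pose B := (\max_(w <- ws) \max_(b <- w) b).+1.
have F0 (w : seq nat) : 0 <= \prod_(b <- w) h b by apply: prodr_ge0 => b _.
apply: le_trans (geometric_tail m S l01).
have group : \sum_(w <- ws) \prod_(b <- w) h b =
    \sum_(m <= n < S) \sum_(w <- ws | size w == n) \prod_(b <- w) h b.
  rewrite (exchange_big_dep xpredT)//= big_seq [RHS]big_seq.
  apply: eq_bigr => w ww; rewrite [RHS](eq_bigl (fun n => n == size w)); last first.
    by move=> n; rewrite eq_sym.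
  rewrite big_nat1_eq ifT//.
  rewrite wm//= /S ltnS; exact: leq_bigmax_seq.
rewrite group; apply: ler_sum_nat => n _.
rewrite -big_filter; apply: (@le_trans _ _ ((\sum_(b <- index_iota 2 B) h b) ^+ n)).
  rewrite -sum_words; apply: sum_uniq_subset => //; first exact: filter_uniq.
  move=> w; rewrite mem_filter => /andP[/eqP wn ww]; apply: mem_words => //.
  apply/allP => b bw; rewrite /= mem_index_iota; apply/andP; split.
    by have /allP := wd w ww; apply.
  rewrite /B ltnS; apply: (@leq_trans (\max_(c <- w) c)).
    exact: (@leq_bigmax_seq _ w xpredT id).
  exact: (@leq_bigmax_seq _ ws xpredT (fun w => \max_(c <- w) c)).
by apply: lerXn2r; rewrite ?nnegrE// sumr_ge0.
Qed.

(* Markov's inequality: [expR (theta * (psi b - beta))] has product at least 1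
   over the digits of a word whose mean is at least [beta]. *)
Definition digit_weight (psi : nat -> R) (s theta beta : R) (b : nat) : R :=
  expR (theta * (psi b - beta)) * ((b%:R - 1) ^- 2) `^ s.

Lemma digit_weight_ge0 psi s theta beta b : 0 <= digit_weight psi s theta beta b.
Proof. by rewrite mulr_ge0 ?expR_ge0 ?powR_ge0. Qed.

Lemma len_powR_le (psi : nat -> R) (s theta beta : R) w :
  0 <= s -> 0 <= theta -> digits w ->
  beta * (size w)%:R <= \sum_(b <- w) psi b ->
  len w `^ s <= \prod_(b <- w) digit_weight psi s theta beta b.
Proof.
move=> s0 t0 wd mean; rewrite big_split/=.
have prod_pow v : \prod_(b <- v) ((b%:R - 1 : R) ^- 2) `^ s =
    (\prod_(b <- v) (b%:R - 1 : R) ^- 2) `^ s.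
  elim: v => [|b v IH]; first by rewrite !big_nil powR1.
  rewrite !big_cons IH powRM//; first by rewrite invr_ge0 sqr_ge0.
  by apply: prodr_ge0 => c _; rewrite invr_ge0 sqr_ge0.
have prod_exp v : \prod_(b <- v) expR (theta * (psi b - beta)) =
    expR (theta * (\sum_(b <- v) psi b - beta * (size v)%:R)).
  elim: v => [|b v IH]; first by rewrite !big_nil mulr0 subr0 mulr0 expR0.
  by rewrite !big_cons IH -expRD -[size (b :: v)]add1n natrD; congr expR; ring.
rewrite prod_pow prod_exp -[leLHS]mul1r; apply: ler_pM => //; first exact: powR_ge0.
  by rewrite -[leLHS]expR0 ler_expR mulr_ge0// subr_ge0.
apply: ge0_ler_powR; rewrite ?nnegrE//.
- by rewrite ltW// len_gt0.
- by apply: prodr_ge0 => c _; rewrite invr_ge0 sqr_ge0.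
- exact: len_le_prod.
Qed.

Lemma cyl_dist w (x y : R) : cyl w x -> cyl w y -> `|x - y| <= len w.
Proof.
rewrite /cyl/= !in_itv/= /len => /andP[? ?] /andP[? ?].
by rewrite ler_norml; apply/andP; split; lra.
Qed.

(** Since [N] depends on [x], the cover uses the words of every length at least [m] whose mean is at
    least [beta]. *)
Lemma hausdorff_large_means (psi : nat -> R) (s theta beta lam : R) (E : set R) :
  0 < s -> 0 <= theta -> 0 <= lam < 1 ->
  (forall B, \sum_(2 <= b < B) digit_weight psi s theta beta b <= lam) ->
  (forall x, E x -> 0 <= x < 1 /\ exists N, forall n, (N <= n)%N ->
     beta * n%:R <= \sum_(0 <= k < n) psi (bcf_digit k.+1 x)) ->
  hausdorff_measure s E = 0%E.
Proof.
move=> s0 t0 l01 hlam EP; have /andP[l0 l1] := l01.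
pose h := digit_weight psi s theta beta.
apply: hausdorff_measure_eq0 => // c c0.
have [m mc] : exists m, lam ^+ m / (1 - lam) <= c.
  have /cvgrPdist_le/(_ (c * (1 - lam))) : lam ^+ n @[n --> \oo] --> 0.
    by apply: cvg_expr; rewrite ger0_norm.
  rewrite mulr_gt0 ?subr_gt0// => /(_ isT)[m _ /(_ m (leqnn m))]/=.
  rewrite sub0r normrN ger0_norm ?exprn_ge0// => lm.
  by exists m; rewrite ler_pdivrMr ?subr_gt0.
pose good w := [&& digits w, (m <= size w)%N &
  beta * (size w)%:R <= \sum_(b <- w) psi b].
(* Indices that code no good word carry the empty set, of weight 0. *)
pose U i : set R := if pickle_inv i is Some w then
  (if good w then cyl w else set0) else set0.
exists U.
  move=> x /EP[x01 [N NP]].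
  pose w := mkseq (fun k => bcf_digit k.+1 x) (maxn m N).
  have wg : good w.
    apply/and3P; split; first exact: digits_bcf.
      by rewrite size_mkseq leq_maxl.
    have -> : \sum_(b <- w) psi b = \sum_(0 <= k < maxn m N) psi (bcf_digit k.+1 x).
      by rewrite /w /mkseq big_map /index_iota subn0.
    by rewrite size_mkseq; apply: NP; rewrite leq_maxr.
  by exists (pickle w) => //; rewrite /U pickleK_inv wg; exact: cyl_mkseq.
apply: nneseries_le => [i|n]; first exact: diam_pow_ge0.
pose v i : R := if pickle_inv i is Some w then
  (if good w then \prod_(b <- w) h b else 0) else 0 : R.
apply: (@le_trans _ _ (\sum_(0 <= i < n) (v i)%:E)%E).
  apply: lee_sum => i _; rewrite /U /v; case: pickle_inv => [w|]; last first.
    by rewrite /diam_pow eqxx.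
  case: ifPn => [/and3P[wd _ wm]|_]; last by rewrite /diam_pow eqxx.
  apply: (@le_trans _ _ (len w `^ s)%:E).
    apply: diam_pow_le; [exact: ltW|by rewrite ltW// len_gt0|exact: cyl_dist].
  by rewrite lee_fin len_powR_le// ltW.
rewrite sumEFin lee_fin; apply: le_trans mc.
pose ws := [seq w <- pmap pickle_inv (index_iota 0 n) | good w].
have -> : \sum_(0 <= i < n) v i = \sum_(w <- ws) \prod_(b <- w) h b.
  rewrite /ws big_filter /v; elim: (index_iota 0 n) => [|i s' IH].
    by rewrite !big_nil.
  rewrite big_cons IH/=; case: pickle_inv => [w|]/=; last by rewrite add0r.
  by rewrite [RHS]big_cons; case: ifP; rewrite ?add0r.
apply: (@sum_distinct_words lam h) => //.
- by move=> b; exact: digit_weight_ge0.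
- apply: filter_uniq; apply: (pmap_uniq (@pickle_invK _)); exact: iota_uniq.
- by apply/allP => w; rewrite mem_filter => /andP[/and3P[]].
- by apply/allP => w; rewrite mem_filter => /andP[/and3P[]].
Qed.

End WordSums.

(** * Explicit bounds for sums of digit weights *)

Section Numerics.
Context {R : realType}.

Lemma powR_expR (x r : R) : 0 < x -> x `^ r = expR (r * ln x).
Proof. by move=> x0; rewrite /powR gt_eqF. Qed.

(** A discrete integral comparison: the ratio of the two powers is [exp (r ln (1 + 1/k))], and
    [exp y >= 1 + y], [ln (1 + 1/k) >= 1/(k + 1)]. *)
Lemma powR_telescope (r : R) k : 0 < r -> (0 < k)%N ->
  r * k.+1%:R `^ (- (r + 1)) <= k%:R `^ (- r) - k.+1%:R `^ (- r).
Proof.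
move=> r0 k0; have kR : (0 : R) < k%:R by rewrite ltr0n.
have kS : (0 : R) < k.+1%:R by rewrite ltr0n.
have lnk : k.+1%:R^-1 <= ln k.+1%:R - ln k%:R :> R.
  have E : k%:R / k.+1%:R = 1 + - k.+1%:R^-1 :> R.
    by rewrite -{1}(addrK 1 k%:R) natr1 mulrBl divff ?gt_eqF// mul1r.
  have V : ln (k%:R / k.+1%:R) = ln k%:R - ln k.+1%:R :> R by rewrite ln_div.
  rewrite -lerN2 opprB -V E; apply: le_ln1Dx.
  by rewrite ltrN2 invf_lt1// ltr1n ltnS.
have -> : k%:R `^ (- r) = k.+1%:R `^ (- r) * expR (r * (ln k.+1%:R - ln k%:R)) :> R.
  by rewrite !powR_expR// -expRD; congr expR; ring.
have -> : k.+1%:R `^ (- (r + 1)) = k.+1%:R `^ (- r) / k.+1%:R :> R.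
  by rewrite opprD powRD ?(gt_eqF kS) ?implybT// powR_inv1// ltW.
have p0 : 0 < k.+1%:R `^ (- r) :> R by rewrite powR_gt0.
rewrite mulrCA -[X in _ - X]mulr1 -mulrBr ler_pM2l//.
rewrite lerBrDl; apply: le_trans (expR_ge1Dx _).
by rewrite lerD2l ler_pM2l.
Qed.

Lemma sum_powR_tail (r : R) n N : 0 < r -> (0 < n)%N ->
  \sum_(n.+1 <= k < N) k%:R `^ (- (r + 1)) <= n%:R `^ (- r) / r.
Proof.
move=> r0 n0; rewrite ler_pdivlMr// mulrC mulr_sumr.
have [Nn|nN] := leqP N n.+1; first by rewrite big_geq// powR_ge0.
rewrite big_add1; apply: (@le_trans _ _ (\sum_(n <= k < N.-1)
    (k%:R `^ (- r) - k.+1%:R `^ (- r)))).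
  rewrite big_nat [leRHS]big_nat; apply: ler_sum => k /andP[nk _].
  by apply: powR_telescope => //; exact: leq_trans nk.
under eq_bigr do rewrite -opprB.
by rewrite sumrN telescope_sumr ?opprB ?gerBl ?powR_ge0//; lia.
Qed.

Lemma digit_weightE (psi : nat -> R) (s theta beta : R) b : (2 <= b)%N ->
  digit_weight psi s theta beta b =
    expR (theta * (psi b - beta)) * b.-1%:R `^ (- (2 * s)).
Proof.
case: b => [|[|b]]// _; rewrite /digit_weight -natr1 addrK/=.
congr (_ * _); have b0 : (0 : R) < b.+1%:R by rewrite ltr0n.
by rewrite -powR_invn ?ltW// -powRrM mulNr.
Qed.

(** The left side bounds the sum of [k^(-11/6)] over [k >= 2]: the first term is [2^(-11/6)] and the
    tail at most [(6/5) 2^(-5/6) = (12/5) 2^(-11/6)]. Sixth powers reduce the claim to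
    [(17/5)^6 < 2^11]. *)
Lemma powR2_small : 2 `^ (- (11 / 6)) * (17 / 5) < 1 :> R.
Proof.
have y0 : 0 < 2 `^ (11 / 6) :> R by rewrite powR_gt0.
rewrite powRN mulrC ltr_pdivrMr// mul1r ltNge; apply/negP => le.
have : (2 `^ (11 / 6)) ^+ 6 <= (17 / 5) ^+ 6 :> R.
  by apply: lerXn2r; rewrite ?nnegrE ?powR_ge0//; lra.
rewrite -powR_mulrn ?powR_ge0// -powRrM (_ : 11 / 6 * 6%:R = 11%:R); last by field.
by rewrite powR_mulrn// !exprS !expr0; lra.
Qed.

Lemma sum_digit_weight_bounded (psi : nat -> R) (m : R) :
  psi 2%N < m -> (forall b, (2 <= b)%N -> psi b <= m) ->
  exists s theta beta lam : R, [/\ 0 < s < 1, 0 <= theta, 0 <= lam < 1, beta < m &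
    forall B, \sum_(2 <= b < B) digit_weight psi s theta beta b <= lam].
Proof.
move=> lt pm; pose W : R := 2 `^ (- (11 / 6)) * (17 / 5).
have W1 : W < 1 := powR2_small.
have W0 : 0 < W by rewrite mulr_gt0 ?powR_gt0//; lra.
(* [theta] is chosen so that the digit 2 has weight [u] at [beta = m], where the total is at most
   [kap < 1]. Lowering [beta] by [delta] costs only a factor [kap^(-1/2)]. *)
pose u := (1 - W) / 3; pose kap := u + W.
have u0 : 0 < u by rewrite /u; lra.
have u1 : u < 1 by rewrite /u; lra.
have k0 : 0 < kap by rewrite /kap; lra.
have k1 : kap < 1 by rewrite /kap /u; lra.
pose theta := - ln u / (m - psi 2%N).
have d0 : 0 < m - psi 2%N by rewrite subr_gt0.
have lu : ln u < 0 by rewrite ln_lt0// u0.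
have lk : ln kap < 0 by rewrite ln_lt0// k0.
have t0 : 0 < theta by rewrite divr_gt0// oppr_gt0.
pose delta := - ln kap / (2 * theta).
have dl0 : 0 < delta by rewrite divr_gt0 ?oppr_gt0// mulr_gt0.
exists (11 / 12), theta, (m - delta), (expR (ln kap / 2)); split.
- by apply/andP; split; lra.
- exact: ltW.
- by rewrite expR_ge0/= expR_lt1; lra.
- by rewrite ltrBlDr ltrDl.
have td : theta * delta = - ln kap / 2.
  by rewrite /delta; field; rewrite gt_eqF.
move=> B; have [B2|B2] := leqP B 2; first by rewrite big_geq// expR_ge0.
have first : digit_weight psi (11 / 12) theta (m - delta) 2 = expR (- ln kap / 2) * u.
  rewrite digit_weightE//= powR1 mulr1 -td -[X in _ = _ * X](lnK (_ : u \is Num.pos)) ?posrE//.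
  rewrite -expRD; congr expR.
  have -> : ln u = - theta * (m - psi 2%N) by rewrite /theta; field; rewrite gt_eqF.
  by ring.
have rest : \sum_(3 <= b < B) digit_weight psi (11 / 12) theta (m - delta) b <=
    expR (- ln kap / 2) * W.
  apply: (@le_trans _ _ (\sum_(3 <= b < B)
      (expR (- ln kap / 2) * b.-1%:R `^ (- (5 / 6 + 1))))).
    rewrite big_nat [leRHS]big_nat; apply: ler_sum => b /andP[b3 _].
    rewrite digit_weightE; last exact: ltnW.
    rewrite (_ : 2 * (11 / 12) = 5 / 6 + 1); last by field.
    rewrite ler_wpM2r ?powR_ge0// ler_expR -td ler_wpM2l ?(ltW t0)//.
    by have := pm b (ltnW b3); lra.
  rewrite -mulr_sumr ler_wpM2l ?expR_ge0// big_add1/=.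
  have [B3|B3] := leqP B.-1 2; first by rewrite big_geq// ltW.
  rewrite big_ltn//=.
  have := @sum_powR_tail (5 / 6) 2 B.-1 ltac:(by lra) isT.
  have -> : 2 `^ (- (5 / 6)) = 2 * 2 `^ (- (11 / 6)) :> R.
    rewrite (_ : - (5 / 6) = 1 + - (11 / 6)); last by field.
    by rewrite powRD ?powRr1// pnatr_eq0 implybT.
  rewrite /W (_ : 5 / 6 + 1 = 11 / 6 :> R); last by field.
  move=> tail; apply: (le_trans (lerD (lexx _) tail)).
  by rewrite le_eqVlt; apply/orP; left; apply/eqP; field.
rewrite big_ltn// first; apply: (le_trans (lerD (lexx _) rest)).
rewrite -mulrDr -/kap -[X in _ * X <= _](lnK (_ : kap \is Num.pos)) ?posrE//.
by rewrite -expRD ler_expR; lra.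
Qed.

(** With [theta C2 = 1/2] the exponential costs a factor [b^(1/2)], turning the exponent [-11/6]
    into [-4/3]. In [beta], [ln 2 / 2] pays for replacing [b] by [b - 1] and [ln 8] gives the factor
    1/8, while the sum of [k^(-4/3)] is at most [1 + 3]. *)
Lemma sum_digit_weight_log (psi : nat -> R) (C1 C2 : R) : 0 < C2 ->
  (forall b, (2 <= b)%N -> psi b <= C1 + C2 * ln b%:R) ->
  exists s theta beta lam : R, [/\ 0 < s < 1, 0 <= theta, 0 <= lam < 1 &
    forall B, \sum_(2 <= b < B) digit_weight psi s theta beta b <= lam].
Proof.
move=> C20 pC; pose theta := (2 * C2)^-1.
have t0 : 0 < theta by rewrite invr_gt0 mulr_gt0.
pose beta := C1 + (ln 2 / 2 + ln 8) / theta.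
exists (11 / 12), theta, beta, 2^-1; split.
- by apply/andP; split; lra.
- exact: ltW.
- by apply/andP; split; lra.
move=> B; have [B2|B2] := leqP B 2; first by rewrite big_geq// invr_ge0.
apply: (@le_trans _ _ (\sum_(2 <= b < B) 8^-1 * b.-1%:R `^ (- (3^-1 + 1)))).
  rewrite big_nat [leRHS]big_nat; apply: ler_sum => b /andP[b2 _].
  rewrite digit_weightE//.
  have b1 : (0 : R) < b.-1%:R by rewrite ltr0n; case: b b2 => [|[]].
  rewrite !powR_expR// -[8^-1]lnK ?posrE ?invr_gt0// lnV ?posrE// -!expRD ler_expR.
  have lb : ln b%:R <= ln 2 + ln b.-1%:R :> R.
    rewrite -lnM ?posrE// ler_ln ?posrE ?mulr_gt0// ?ltr0n; last by lia.
    by rewrite -natrM ler_nat; lia.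
  have pb := pC b b2.
  have tC : theta * C2 = 2^-1 by rewrite /theta; field; rewrite gt_eqF.
  have tb : theta * beta = theta * C1 + (ln 2 / 2 + ln 8).
    by rewrite /beta; field; rewrite gt_eqF.
  have : theta * psi b <= theta * C1 + 2^-1 * ln b%:R.
    by rewrite -tC -mulrA -mulrDr ler_pM2l.
  by rewrite mulrBr tb; lra.
rewrite -mulr_sumr big_add1/=.
have [B3|B3] := leqP B.-1 1; first by rewrite big_geq// mulr0 invr_ge0.
rewrite big_ltn//= powR1.
have := @sum_powR_tail 3^-1 1 B.-1 ltac:(by lra) isT.
by rewrite powR1; lra.
Qed.

End Numerics.

(** * Growth of psi and the dichotomy for level sets *)

Section Main.
Context {R : realType}.
Variable psi : nat -> R.
Hypothesis psi_mono : forall m n : nat, (2 <= m)%N -> (m <= n)%N -> psi m <= psi n.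
Local Notation psi_oo := (limn (fun n => (psi n)%:E)).

Lemma psi_le_lim b : (2 <= b)%N -> ((psi b)%:E <= psi_oo)%E.
Proof.
(* Monotonicity only starts at 2, hence the shift. *)
move=> b2; pose u n := (psi (n + 2)%N)%:E.
have u_nd : nondecreasing_seq u.
  by move=> m n mn; rewrite lee_fin psi_mono ?leq_addl// leq_add2r.
have := ereal_nondecreasing_cvgn u_nd.
rewrite (@cvg_shiftn 2 _ (fun n => (psi n)%:E)) => /cvg_lim -> //.
by apply: ereal_sup_ubound; exists (b - 2)%N; rewrite //= /u subnK.
Qed.

(** The quotient is eventually below a finite constant; the earlier values are controlled by
    monotonicity. *)
Lemma psi_log_bound : cvg ((psi n / ln n%:R)%:E @[n --> \oo]) ->
  ~ ((psi n / ln n%:R)%:E @[n --> \oo] --> +oo%E) ->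
  exists C1 C2 : R, 0 < C2 /\
    forall b, (2 <= b)%N -> psi b <= C1 + C2 * ln b%:R.
Proof.
move=> cv slow; set l := lim _ in cv.
have [K lK] : exists K : R, (l < K%:E)%E.
  case: l cv => [r| |] cv //; first by exists (r + 1); rewrite lte_fin ltrDl.
  by exists 0; rewrite ltNyr.
have [N _ NP] : \forall n \near \oo, ((psi n / ln n%:R)%:E < K%:E)%E.
  by apply: (cv [set y | (y < K%:E)%E]); exact: open_ereal_lt'.
have C20 : 0 < `|K| + 1 by rewrite ltr_wpDl.
exists `|psi (maxn N 2)|, (`|K| + 1); split => // b b2.
have lb : 0 < ln b%:R :> R by rewrite ln_gt0// ltr1n.
have [Nb|bN] := leqP N b.
  have := NP b Nb; rewrite /= lte_fin ltr_pdivrMr// => /ltW h.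
  rewrite (le_trans h)// -[leLHS]add0r lerD// ler_wpM2r ?(ltW lb)//.
  by rewrite (le_trans (ler_norm _))// lerDl.
rewrite -[leLHS]addr0 lerD// ?mulr_ge0 ?(ltW C20) ?(ltW lb)//.
rewrite (le_trans _ (ler_norm _))// psi_mono// leq_max.
by rewrite (ltnW bN).
Qed.

Lemma level_set_itv (alpha : \bar R) : mean_level_set psi alpha `<=` `[0%R, 1%R[.
Proof. by move=> x [/andP[x0 x1] _ _]; rewrite /= in_itv/= (ltW x0). Qed.

Lemma sum_ge_mean (x beta : R) n : (0 < n)%N -> beta <= birkhoff_mean psi x n ->
  beta * n%:R <= \sum_(0 <= k < n) psi (bcf_digit k.+1 x).
Proof.
move=> n0; rewrite -subr_ge0 birkhoff_mean_sub// pmulr_rge0 ?invr_gt0 ?ltr0n//.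
by rewrite sumrB sumr_const_nat subn0 subr_ge0 mulr_natr.
Qed.

Lemma hausdorff_dim_level_lt1 (alpha : \bar R) (s theta beta lam : R) :
  0 < s < 1 -> 0 <= theta -> 0 <= lam < 1 ->
  (forall B, \sum_(2 <= b < B) digit_weight psi s theta beta b <= lam) ->
  (beta%:E < alpha)%E -> (hausdorff_dim (mean_level_set psi alpha) < 1)%E.
Proof.
move=> /andP[s0 s1] t0 l01 hlam ba; apply: (@hausdorff_dim_lt1 R s); rewrite ?ltW//.
apply: (hausdorff_large_means s0 t0 l01 hlam) => x [/andP[x0 x1] _ mx].
split; first by rewrite (ltW x0).
have [N _ NP] : \forall n \near \oo, (beta%:E < (birkhoff_mean psi x n)%:E)%E.
  by apply: (mx [set y | (beta%:E < y)%E]); exact: open_ereal_gt'.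
exists (maxn N 1) => n; rewrite geq_max => /andP[/NP/= Nn n1].
by apply: sum_ge_mean => //; move: Nn; rewrite lte_fin => /ltW.
Qed.

Lemma hausdorff_dim_level_eq1 (alpha : \bar R) :
  (forall s, 0 <= s < 1 -> hausdorff_measure s (mean_level_set psi alpha) != 0%E) ->
  hausdorff_dim (mean_level_set psi alpha) = 1%E.
Proof.
move=> pos; apply: hausdorff_dim_eq1; first exact: level_set_itv.
by move=> s s0 s1; apply: pos; rewrite s0.
Qed.

End Main.

Theorem theorem1p7 (R : realType) (psi : nat -> R)
    (psi_mono : forall m n : nat, (2 <= m)%N -> (m <= n)%N -> psi m <= psi n)
    (psi_log : cvg ((psi n / ln n%:R)%:E @[n --> \oo])) :
  (forall alpha : \bar R,
     ((psi 2%N)%:E <= alpha)%E -> (alpha <= limn (fun n => (psi n)%:E))%E ->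
     hausdorff_dim (mean_level_set psi alpha) = 1%:E)
  <->
  (((psi n / ln n%:R)%:E @[n --> \oo] --> +oo%E) \/
   (psi 2%N)%:E = limn (fun n => (psi n)%:E)).
Proof.
split=> [full_dim|].
  apply: contrapT => /not_orP[slow nconst].
  have lt : ((psi 2%N)%:E < limn (fun n => (psi n)%:E))%E.
    by rewrite lt_neqAle psi_le_lim// andbT; apply/eqP.
  have {full_dim} := full_dim _ (ltW lt) (lexx _).
  have := @psi_le_lim R psi psi_mono; move: lt {nconst}.
  (* A finite limit [m] is the bounded case. If the limit is infinite, [slow] yields a logarithmic
     bound, and every real [beta] lies below the level. *)
  case: (limn _) => [m| |]// lt pm; apply/eqP; rewrite lt_eqF//.
    have [s [theta [beta [lam [s01 t0 l01 bm hlam]]]]] :=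
      @sum_digit_weight_bounded R psi m lt pm.
    exact: (hausdorff_dim_level_lt1 s01 t0 l01 hlam).
  have [C1 [C2 [C20 pC]]] := psi_log_bound psi_mono psi_log slow.
  have [s [theta [beta [lam [s01 t0 l01 hlam]]]]] := sum_digit_weight_log C20 pC.
  by apply: (hausdorff_dim_level_lt1 s01 t0 l01 hlam); rewrite ltry.
move=> [fast|const] alpha lo hi; apply: hausdorff_dim_level_eq1 => s s01.
  case: alpha lo {hi} => [a| |]// lo.
    move: lo; rewrite lee_fin le_eqVlt => /predU1P[<-|lo].
      exact: level_set_min_pos.
    have [C CP] := insertion_params fast lo.
    exact: level_set_pos CP.
  apply: infinite_level_set_pos => // [b b2|]; first exact: psi_mono.
  exact: digit_params.
(* The interval of levels is a single point here. *)
have -> : alpha = (psi 2%N)%:E by apply/le_anti; rewrite lo const hi.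
exact: level_set_min_pos.
Qed.
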